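(* Let $\mathcal{E}=\mathcal{E}_1\cup\mathcal{E}_2$ be a finite set, with $\mathcal{E}_1,\mathcal{E}_2$ non-empty and disjoint, and let $K$ be a sub-Markovian kernel on $\mathcal{E}$ such that: (1) for $i=1,2$, $x\hookrightarrow y$ for all $x,y\in\mathcal{E}_i$; (2) $\mathcal{E}_1\hookrightarrow\mathcal{E}_2$; (3) $\mathcal{E}_2\not\hookrightarrow\mathcal{E}_1$; (4) there is $x\in\mathcal{E}_2$ with $K(x,\mathcal{E})<1$, while $K(x,\mathcal{E})=1$ for all $x\in\mathcal{E}_1$. Let $\Theta_1,\Theta_2$ be the extinction rates (spectral radii) of the restrictions $K_1,K_2$ of $K$ to $\mathcal{E}_1,\mathcal{E}_2$, and let $\mu_2^\star$ be the unique quasi-stationary distribution of $K_2$, viewed as an element of $\mathcal{P}(\mathcal{E})$. Then condition $\mathbf{H_4}$ (defined in the context) holds if and only if $\Theta_1\le\Theta_2$. In this case the unique quasi-stationary distribution of $K$ is $\mu_2^\star$ and, if $(\gamma_n)_{n\ge0}$ is non-increasing with $\sum_{n\ge0}\gamma_n=+\infty$ and $\lim_{n\to\infty}\gamma_n\ln(n)=0$, then $\mu_n\to\mu_2^\star$ almost surely.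
   Context: $\mathcal{E}$ is endowed with the discrete topology; $K(x,y)=K(x,\{y\})$; $\mathbf{1}$ is the constant function $1$. $\mathcal{P}(\mathcal{E})$ is the set of probabilities on $\mathcal{E}$; $\mathcal{P}(\mathcal{E}_i)$ is identified with the probabilities on $\mathcal{E}$ supported in $\mathcal{E}_i$. A sub-Markovian kernel $K$ on $\mathcal{E}$ is a matrix with non-negative entries and $0<K(x,\mathcal{E})=\sum_yK(x,y)\le1$ for every $x$; $K^n$ is its $n$-th power. For $x,y\in\mathcal{E}$, $x\hookrightarrow y$ means $\sum_{n\ge0}K^n(x,y)>0$; for $A,B\subset\mathcal{E}$, $A\hookrightarrow B$ means that $x\hookrightarrow y$ for some $x\in A$, $y\in B$. A quasi-stationary distribution (QSD) of a kernel $Q$ is a probability $\mu$ with $\mu=\mu Q/(\mu Q\mathbf{1})$, and its extinction rate is $\mu Q\mathbf{1}$. $K_i=(K(x,y))_{x,y\in\mathcal{E}_i}$; by irreducibility and Perron–Frobenius, the extinction rate $\Theta_i$ of the unique QSD of $K_i$ is the spectral radius of $K_i$. Condition $\mathbf{H_4}$: there exists a non-increasing convex function $C:\mathbb{R}^+\to\mathbb{R}^+$ with $\int_0^\infty C(s)\,ds=\infty$ such that $\Psi(K^n\mathbf{1})\ge C(n)\sup_{x\in\mathcal{E}}K^n\mathbf{1}(x)$ for all $n$, where $\Psi$ is a probability measure on $\mathcal{E}$ associated with an accessible weak small set, that is: there are a non-empty set $U\subset\mathcal{E}$ and $\epsilon>0$ with $\sum_{n\ge1}K^n(x,U)>0$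 for all $x\in\mathcal{E}$ and $\sum_{n\ge1}K^n(x,\cdot)\ge\epsilon\Psi(\cdot)$ for all $x\in U$. (In the present setting such $U,\Psi$ always exist, e.g. $U=\{x_0\}$, $\Psi=\delta_{x_0}$ with $x_0\in\mathcal{E}_2$.) Algorithm: let $\delta(x)=1-K(x,\mathcal{E})$ and $K_\mu(x,A)=K(x,A)+\delta(x)\mu(A)$ for $\mu\in\mathcal{P}(\mathcal{E})$. $(\eta_n)_{n\ge0}$ are positive numbers, $\gamma_n=\eta_n/\sum_{k=0}^n\eta_k$. $(X_n)_{n\ge0}$ is an $\mathcal{E}$-valued process adapted to a filtration $(\mathcal{F}_n)$ with $X_0=x\in\mathcal{E}$ and $\mathbb{P}(X_{n+1}\in dy\mid\mathcal{F}_n)=K_{\mu_n}(X_n,dy)$, where $\mu_n=\sum_{k=0}^n\eta_k\delta_{X_k}/\sum_{k=0}^n\eta_k$. *)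

(* Defs.v *)
From HB Require Import structures.
From mathcomp Require Import all_boot all_order all_algebra.
From mathcomp Require Import complex.
From mathcomp Require Import all_classical all_reals all_analysis.

Set Implicit Arguments.
Unset Strict Implicit.
Unset Printing Implicit Defensive.

Import Order.TTheory GRing.Theory Num.Theory.
Import numFieldNormedType.Exports.

Local Open Scope classical_set_scope.
Local Open Scope ring_scope.

(* On a finite set E, functions and measures are both maps E -> R, and a kernel
   is the matrix Q x y = Q(x, {y}). *)

Section Kernels.
Variables (R : realType) (E : finType).
Implicit Types (Q K : E -> E -> R) (mu : E -> R) (f : E -> R).

Definition is_prob mu : Prop :=
  (forall x, 0 <= mu x) /\ \sum_x mu x = 1.

Definition expect mu f : R := \sum_x mu x * f x.

Definition kfun Q f : E -> R := fun x => \sum_y Q x y * f y.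

Definition mkernel mu Q : E -> R := fun y => \sum_x mu x * Q x y.

Definition one : E -> R := fun=> 1.

Fixpoint kpow Q (n : nat) : E -> E -> R :=
  if n is m.+1 then fun x y => \sum_z Q x z * kpow Q m z y
  else fun x y => (x == y)%:R.

Definition mass Q (x : E) (A : {set E}) : R := \sum_(y in A) Q x y.

Definition sub_Markovian K : Prop :=
  (forall x y, 0 <= K x y) /\
  (forall x, 0 < mass K x [set: E]%SET /\ mass K x [set: E]%SET <= 1).

Definition leads K (x y : E) : Prop :=
  (0 < \sum_(0 <= n <oo) (kpow K n x y)%:E)%E.

Definition leads_set K (A B : {set E}) : Prop :=
  exists x y, [/\ x \in A, y \in B & leads K x y].

Definition extinction_rate Q mu : R := expect mu (kfun Q one).

(* If extinction_rate Q mu = 0 the quotient is 0, so such a mu is not a QSD. *)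
Definition is_qsd Q mu : Prop :=
  is_prob mu /\ forall y, mu y = mkernel mu Q y / extinction_rate Q mu.

Definition kernel_mx Q : 'M[R]_#|E| :=
  \matrix_(i, j) Q (enum_val i) (enum_val j).

Definition spectral_radius Q : R :=
  sup [set r : R | exists2 l : R[i],
         eigenvalue (map_mx (real_complex R) (kernel_mx Q)) l
         & r = ComplexField.Normc.normc l].

(* Psi is associated with an accessible weak small set. *)
Definition weak_small_measure K (Psi : E -> R) : Prop :=
  exists (U : {set E}) (eps : R),
    [/\ U != finset.set0, 0 < eps,
        forall x, (0 < \sum_(1 <= n <oo) (mass (kpow K n) x U)%:E)%E
      & forall x y, x \in U ->
          ((eps * Psi y)%:E <= \sum_(1 <= n <oo) (kpow K n x y)%:E)%E].

(* Only the values of C on [0, +oo[ matter. *)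
Definition H4 K : Prop :=
  exists Psi : E -> R, [/\ is_prob Psi, weak_small_measure K Psi &
  exists C : R -> R,
    [/\ forall s, 0 <= s -> 0 <= C s,
        forall s t, 0 <= s -> s <= t -> C t <= C s,
        convex_function (`[0, +oo[%classic : set R^o) C,
        (\int[@lebesgue_measure R]_(s in `[0%R, +oo[) (C s)%:E = +oo)%E
      & forall n : nat,
          C n%:R * sup (range (kfun (kpow K n) one))
          <= expect Psi (kfun (kpow K n) one)]].

Definition restr K (A : {set E}) (x y : {z : E | z \in A}) : R :=
  K (val x) (val y).

(* A measure on A, viewed as a measure on E supported in A. *)
Definition extend (A : {set E}) (nu : {z : E | z \in A} -> R) : E -> R :=
  fun x => oapp nu 0 (insub x).

(* K_mu = K + delta (x) mu, where delta x = 1 - K(x, E). *)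
Definition Kmu K mu (x y : E) : R :=
  K x y + (1 - mass K x [set: E]%SET) * mu y.

(* Weak convergence: every function on the finite discrete space E is bounded
   and continuous. *)
Definition weak_cvg (mus : nat -> E -> R) (mu : E -> R) : Prop :=
  forall f : E -> R, expect (mus n) f @[n --> \oo] --> expect mu f.

End Kernels.

Arguments restr {R E} K A x y.

Definition gamma (R : realType) (eta : nat -> R) (n : nat) : R :=
  eta n / \sum_(k < n.+1) eta k.

Section Process.
Variables (R : realType) (E : finType).
Variables (d : measure_display) (T : measurableType d) (P : probability T R).

Definition occupation (eta : nat -> R) (X : nat -> T -> E)
    (n : nat) (w : T) : E -> R :=
  fun y => (\sum_(k < n.+1) eta k * (X k w == y)%:R) / \sum_(k < n.+1) eta k.

Definition filtration (F : nat -> set (set T)) : Prop :=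
  [/\ forall n, sigma_algebra [set: T] (F n),
      forall n, F n `<=` measurable
    & forall n, F n `<=` F n.+1].

(* f is a version of the conditional probability P(B | G). *)
Definition is_cond_prob (G : set (set T)) (B : set T) (f : T -> R) : Prop :=
  (forall S : set R, measurable S -> G (f @^-1` S)) /\
  (forall A : set T, G A -> P (A `&` B) = (\int[P]_(w in A) (f w)%:E)%E).

Definition reinforced_process (K : E -> E -> R) (eta : nat -> R) (x0 : E)
    (F : nat -> set (set T)) (X : nat -> T -> E) : Prop :=
  [/\ filtration F,
      forall n y, F n (X n @^-1` [set y]),
      forall w, X 0%N w = x0
    & forall n y, is_cond_prob (F n) (X n.+1 @^-1` [set y])
                    (fun w => Kmu K (occupation eta X n w) (X n w) y)].

End Process.

(* Main.v *)
Require Import Defs.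
From HB Require Import structures.
From mathcomp Require Import all_boot all_order all_algebra.
From mathcomp Require Import complex zify ring lra.
From mathcomp Require Import all_classical all_reals all_analysis.
From mathcomp Require Import measurable_realfun.

(** Write G = (I - K)^-1 and a_n = 1 - K(X_n, E).  For f = G g one has f - K f = g, so
    g(X_n) = a_n mu_n(G g) + (martingale increment) + (telescoping term): no Poisson
    equation for K_mu is needed, and in the time scale of gamma the occupation measure is
    a perturbation of mu' = - mu + a(t) mu G with a scalar control a(t) >= 0, whose total
    mass is pinned by mu(1) = 1.  Over a window of length T it is an Euler step
      mu_m = (1 - t) mu_n + A mu_n G + O(T^2),   T <= t <= 2 T,  0 <= A <= t,
    as soon as the noise summed over that window is O(T^2).  Only the windows starting at
    each n matter, so a Chernoff bound of order exp (- c / gamma_n), summable since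
    gamma_n ln n -> 0, and Borel-Cantelli suffice: no maximal inequality is needed.

    Let u and h be the right Perron vectors of K_1 and K_2, extended by 0, and pi the
    quasi-stationary distribution of K_2.  If Theta_1 <= Theta_2 then, with
    theta = 1 / (1 - Theta_2), one has G u <= theta u and
    theta h + c u <= G h <= theta h + C u.  Hence mu(u) / mu(u + h) is a Lyapunov function
    (with quadratic decay), and once mu(u) is small so is sum_y |mu(y) - mu(h) pi(y)| h(y) /
    mu(h), by the Doeblin minorization G >= kappa h pi.  Both tend to 0, which gives
    mu_n -> pi.  A quasi-stationary distribution of K is a constant solution of the Euler
    scheme, so it equals pi.

    For H4, on E_2 K^n 1 is of order Theta_2^n; on E_1 it is at most of order
    n Theta_2^n if Theta_1 <= Theta_2, and at least of order Theta_1^n in all cases, while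
    Psi is carried by E_2. *)

Set Implicit Arguments.
Unset Strict Implicit.
Unset Printing Implicit Defensive.

Import Order.TTheory GRing.Theory Num.Theory.
Import numFieldNormedType.Exports.

Local Open Scope classical_set_scope.
Local Open Scope ring_scope.

(** * Powers of non-negative kernels *)

Section NonnegKernel.
Variables (R : realType) (I : finType) (Q : I -> I -> R).
Hypothesis Q_ge0 : forall x y, 0 <= Q x y.

Lemma kpow_ge0 n x y : 0 <= kpow Q n x y.
Proof.
elim: n x y => [|n IH] x y /=; first by case: (x == y); rewrite ?ler01.
by apply: sumr_ge0 => z _; rewrite mulr_ge0.
Qed.

Lemma sum_delta (x : I) (f : I -> R) : \sum_y (x == y)%:R * f y = f x.
Proof.
rewrite (bigD1 x) //= eqxx mul1r big1 ?addr0 // => y.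
by rewrite eq_sym => /negbTE ->; rewrite mul0r.
Qed.

Lemma kpowD m n x y : kpow Q (m + n) x y = \sum_z kpow Q m x z * kpow Q n z y.
Proof.
elim: m x => [|m IH] x; first by rewrite add0n /= sum_delta.
rewrite addSn /=; under eq_bigr do rewrite IH mulr_sumr.
rewrite exchange_big /=; apply: eq_bigr => z _; rewrite mulr_suml.
by apply: eq_bigr => w _; rewrite mulrA.
Qed.

Lemma kpow1 x y : kpow Q 1 x y = Q x y.
Proof.
rewrite /= (bigD1 y) //= eqxx mulr1 big1 ?addr0 // => z /negbTE ->.
by rewrite mulr0.
Qed.

Lemma kpowSr n x y : kpow Q n.+1 x y = \sum_z kpow Q n x z * Q z y.
Proof. by rewrite -addn1 kpowD; under eq_bigr do rewrite kpow1. Qed.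

Lemma kpowD_gt0 m n x y z :
  0 < kpow Q m x y -> 0 < kpow Q n y z -> 0 < kpow Q (m + n) x z.
Proof.
move=> h1 h2; rewrite kpowD (bigD1 y) //= ltr_wpDr ?mulr_gt0 //.
by apply: sumr_ge0 => w _; rewrite mulr_ge0 ?kpow_ge0.
Qed.

Lemma kfun_kpowS n f x : kfun (kpow Q n.+1) f x = kfun Q (kfun (kpow Q n) f) x.
Proof.
rewrite /kfun /=; under eq_bigr do rewrite mulr_suml.
rewrite exchange_big /=; apply: eq_bigr => z _; rewrite mulr_sumr.
by apply: eq_bigr => w _; rewrite mulrA.
Qed.

Lemma kfun_kpow0 f x : kfun (kpow Q 0) f x = f x.
Proof. exact: sum_delta. Qed.

Lemma kfun_kpowC n f x :
  kfun (kpow Q n) (kfun Q f) x = kfun Q (kfun (kpow Q n) f) x.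
Proof.
rewrite -kfun_kpowS /kfun; under eq_bigr do rewrite mulr_sumr.
rewrite exchange_big; apply: eq_bigr => z _; rewrite kpowSr mulr_suml.
by apply: eq_bigr => w _; rewrite mulrA.
Qed.

Lemma kfun_ge0 f x : (forall y, 0 <= f y) -> 0 <= kfun Q f x.
Proof. by move=> f0; apply: sumr_ge0 => y _; rewrite mulr_ge0. Qed.

Lemma kfun_le f g x : (forall y, f y <= g y) -> kfun Q f x <= kfun Q g x.
Proof. by move=> fg; apply: ler_sum => y _; rewrite ler_wpM2l. Qed.

Lemma kfunZ (Q' : I -> I -> R) c f x :
  kfun Q' (fun y => c * f y) x = c * kfun Q' f x.
Proof. by rewrite /kfun mulr_sumr; apply: eq_bigr => y _; rewrite mulrCA. Qed.

Lemma kfunD (Q' : I -> I -> R) f g x :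
  kfun Q' (fun y => f y + g y) x = kfun Q' f x + kfun Q' g x.
Proof. by rewrite /kfun -big_split; apply: eq_bigr => y _; rewrite mulrDr. Qed.

Lemma kfunB (Q' : I -> I -> R) f g x :
  kfun Q' (fun y => f y - g y) x = kfun Q' f x - kfun Q' g x.
Proof. by rewrite /kfun -sumrB; apply: eq_bigr => y _; rewrite mulrBr. Qed.

Lemma kfun_kpow_le s f n x : 0 <= s ->
  (forall y, kfun Q f y <= s * f y) -> kfun (kpow Q n) f x <= s ^+ n * f x.
Proof.
move=> s0 fs; elim: n x => [|n IH] x; first by rewrite kfun_kpow0 mul1r.
rewrite kfun_kpowS; apply: (le_trans (kfun_le x IH)).
by rewrite kfunZ exprSr -mulrA ler_wpM2l ?exprn_ge0.
Qed.

Lemma kfun_kpow_ge s f n x : 0 <= s ->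
  (forall y, s * f y <= kfun Q f y) -> s ^+ n * f x <= kfun (kpow Q n) f x.
Proof.
move=> s0 fs; elim: n x => [|n IH] x; first by rewrite kfun_kpow0 mul1r.
rewrite kfun_kpowS; apply: (le_trans _ (kfun_le x IH)).
by rewrite kfunZ exprSr -mulrA ler_wpM2l ?exprn_ge0.
Qed.

(** A series of non-negative terms vanishes exactly when every term does. This trades the
    extended-real series for a path of some finite length. *)
Lemma leadsP x y : leads Q x y <-> exists n, 0 < kpow Q n x y.
Proof.
split=> [h|[n hn]].
  apply: contrapT => /forallNP Hn; move: h; rewrite /leads.
  rewrite eseries0 ?ltxx // => n _ _.
  by congr (_%:E); apply: le_anti; rewrite kpow_ge0 leNgt andbT; apply/negP.
rewrite /leads; apply: lt_le_trans (_ : (kpow Q n x y)%:E <= _)%E.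
  by rewrite lte_fin.
apply: le_trans (nneseries_lim_ge n.+1 _) => [|k _ _]; last first.
  by rewrite lee_fin kpow_ge0.
rewrite big_nat_recr //= leeDr // sume_ge0 // => k _.
by rewrite lee_fin kpow_ge0.
Qed.

Lemma leads_trans x y z : leads Q x y -> leads Q y z -> leads Q x z.
Proof.
move=> /leadsP[m hm] /leadsP[n hn]; apply/leadsP.
by exists (m + n)%N; apply: kpowD_gt0 hm hn.
Qed.

End NonnegKernel.

Lemma fin_min_gt0 (R : realType) (I : finType) (f : I -> R) :
  (forall x, 0 < f x) -> exists2 c, 0 < c & forall x, c <= f x.
Proof.
move=> f0; have [[x0 _]|no] := pselect (exists x : I, True); last first.
  by exists 1 => // x; case: no; exists x.
exists (f [arg min_(i < x0) f i]%O) => // x.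
by case: arg_minP => // i _; apply.
Qed.

Lemma fin_max_ub (R : realType) (I : finType) (f : I -> R) :
  exists2 c, 0 < c & forall x, f x <= c.
Proof.
exists (1 + \sum_x `|f x|).
  by rewrite ltr_pwDl // sumr_ge0.
move=> x; rewrite (le_trans (ler_norm _)) // (bigD1 x) //= addrCA.
by rewrite lerDl addr_ge0 // sumr_ge0.
Qed.

(** * Perron-Frobenius theory *)

Section PerronFrobenius.
Variables (R : realType) (I : finType).
Implicit Types Q : I -> I -> R.

Definition irreducible_kernel Q := forall x y, exists n, 0 < kpow Q n x y.

Definition ktr Q : I -> I -> R := fun x y => Q y x.

Lemma kpow_ktr Q n x y : kpow (ktr Q) n x y = kpow Q n y x.
Proof.
elim: n x y => [|n IH] x y; first by rewrite /= eq_sym.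
by rewrite kpowSr /=; apply: eq_bigr => z _; rewrite IH mulrC.
Qed.

Lemma irreducible_ktr Q : irreducible_kernel Q -> irreducible_kernel (ktr Q).
Proof. by move=> irr x y; have [n] := irr y x; exists n; rewrite kpow_ktr. Qed.

(** Finiteness of [I] lets one horizon serve all pairs: [N] exceeds every chosen path length, and
    the term at that length is already positive. *)
Lemma irreducible_sum_gt0 Q : (forall x y, 0 <= Q x y) -> irreducible_kernel Q ->
  exists N, forall x y, 0 < \sum_(n < N) kpow Q n x y.
Proof.
move=> Q0 irr; pose f x y := xchoose (irr x y).
exists (\max_(p : I * I) (f p.1 p.2).+1) => x y.
have lt : (f x y < \max_(p : I * I) (f p.1 p.2).+1)%N.
  exact: (@leq_bigmax _ (fun p : I * I => (f p.1 p.2).+1) (x, y)).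
rewrite (bigD1 (Ordinal lt)) //= ltr_wpDr ?(xchooseP (irr x y)) //.
by apply: sumr_ge0 => i _; exact: kpow_ge0.
Qed.

Lemma cvg_fin_sum (T : Type) (F : set_system T) (J : finType)
    (f : J -> T -> R) (l : J -> R) : Filter F ->
  (forall j, f j w @[w --> F] --> l j) ->
  \sum_j f j w @[w --> F] --> \sum_j l j.
Proof. by move=> FF cf; apply: cvg_big => //; exact: add_continuous. Qed.

Lemma cvg_fin_max (T : topologicalType) (J : finType) (f : J -> T -> R) (v : T) :
  (forall j, f j w @[w --> v] --> f j v) ->
  \big[Num.max/0]_j f j w @[w --> v] --> \big[Num.max/0]_j f j v.
Proof. by move=> cf; apply: cvg_big => //; exact: max_continuous. Qed.

(** The simplex is closed inside the compact cube [0, 1]^n. *)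
Lemma simplex_compact n :
  compact [set v : 'rV[R]_n | (forall i, 0 <= v ord0 i) /\ \sum_i v ord0 i = 1].
Proof.
apply: (@subclosed_compact _ _
  [set v : 'rV[R]_n | forall i, `[(0 : R), 1]%classic (v ord0 i)]).
- rewrite (_ : mkset _ =
      \bigcap_(i in [set: 'I_n]) ((fun v : 'rV[R]_n => v ord0 i) @^-1` [set r | 0 <= r])
      `&` (fun v : 'rV[R]_n => \sum_i v ord0 i) @^-1` [set 1]); last first.
    by apply/seteqP; split=> v /= [h1 h2]; split=> // i; [move=> _|]; exact: h1.
  apply: closedI.
    apply: closed_bigI => i _; apply: preimage_closed; last exact: closed_ge.
    by move=> v _; exact: coord_continuous.
  apply: preimage_closed; last exact: closed_eq.
  by move=> v _; apply: (cvg_fin_sum (F := nbhs v)) => i; exact: coord_continuous.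
- by apply: (@rV_compact R n (fun=> `[(0 : R), 1]%classic)) => _; exact: segment_compact.
- move=> v [v0 v1] i /=; rewrite in_itv /= v0 /= -v1 (bigD1 i) //= lerDl.
  by rewrite sumr_ge0.
Qed.

(* Minimise the Collatz-Wielandt function max_x (Q w)(x) / w(x) over the compact
   set of w = S v, where v is in the simplex and S is a positive sum of powers of
   Q; if w were not an eigenvector, replacing w by S w would lower the maximum. *)
Lemma perron_right (x0 : I) Q : (forall x y, 0 <= Q x y) ->
  irreducible_kernel Q ->
  exists r u, [/\ 0 <= r, forall x : I, 0 < u x & forall x, kfun Q u x = r * u x].
Proof.
move=> Q0 irr; have [N S_gt0] := irreducible_sum_gt0 Q0 irr.
set S := fun x y => \sum_(n < N) kpow Q n x y in S_gt0.
(* [S] is a polynomial in [Q], hence commutes with it. *)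
have QS f x : kfun Q (kfun S f) x = kfun S (kfun Q f) x.
  have SE g z : kfun S g z = \sum_(n < N) kfun (kpow Q n) g z.
    rewrite /kfun exchange_big /=; apply: eq_bigr => y _; rewrite mulr_suml //.
  rewrite SE; under eq_bigr do rewrite kfun_kpowC.
  transitivity (\sum_y \sum_(n < N) Q x y * kfun (kpow Q n) f y).
    by apply: eq_bigr => y _; rewrite SE mulr_sumr.
  by rewrite exchange_big.
have S_pos f : (forall x, 0 <= f x) -> (exists x, f x != 0) ->
    forall x, 0 < kfun S f x.
  move=> f0 [z fz] x; rewrite /kfun (bigD1 z) //=; apply: ltr_wpDr.
    by apply: sumr_ge0 => y _; rewrite mulr_ge0 ?f0 ?ltW ?S_gt0.
  by rewrite mulr_gt0 ?S_gt0 // lt_neqAle eq_sym fz f0.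
pose A := [set v : 'rV[R]_#|I| |
  (forall i, 0 <= v ord0 i) /\ \sum_i v ord0 i = 1].
pose fn (v : 'rV[R]_#|I|) x := v ord0 (enum_rank x).
pose w v := kfun S (fn v).
pose F x (v : 'rV[R]_#|I|) : R^o := kfun Q (w v) x / w v x.
(* The base value 0 of the maximum is harmless, the quotients being non-negative. *)
pose f (v : 'rV[R]_#|I|) : R^o := \big[Num.max/0]_(x : I) F x v.
have sum_rank g : \sum_i g i = \sum_(x : I) g (enum_rank x) :> R.
  rewrite (reindex (@enum_rank I)) //.
  by exists enum_val => ? _; [exact: enum_rankK|exact: enum_valK].
have wA v : A v -> forall x, 0 < w v x.
  move=> [v0 v1]; apply: S_pos => [x|]; first exact: v0.
  apply: contrapT => /forallNP nz; move/eqP: v1; rewrite sum_rank big1.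
    by rewrite eq_sym oner_eq0.
  by move=> x _; apply/eqP; move/negP: (nz x); rewrite negbK.
have fnc x : continuous (fun v => fn v x) by exact: coord_continuous.
have kc Q' g : (forall x, continuous (fun v : 'rV[R]_#|I| => g v x)) ->
    forall x : I, continuous (fun v => kfun Q' (g v) x : R^o).
  move=> gc x v; apply: (cvg_fin_sum (F := nbhs v)) => y.
  by apply: (@cvgM R _ (nbhs v) _ (fun=> Q' x y) (fun w => g w y)); [exact: cvg_cst|exact: gc].
have wc x : continuous (fun v => w v x : R^o) by exact: kc.
have Kwc x : continuous (fun v => kfun Q (w v) x : R^o) by exact: kc.
(* The quotients are invariant under scaling, so any positive vector may be brought back to the
   simplex. *)
have normA (g : I -> R) : (forall x, 0 < g x) ->
    exists2 v, A v & exists2 c, 0 < c & forall x, fn v x = c * g x.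
  move=> g0; have sg : 0 < \sum_x g x.
    by rewrite (bigD1 x0) //= ltr_wpDr // sumr_ge0 // => y _; exact: ltW.
  exists (\row_i (g (enum_val i) / \sum_x g x)); last first.
    by exists (\sum_x g x)^-1; rewrite ?invr_gt0 // => x; rewrite /fn mxE enum_rankK mulrC.
  split=> [i|]; first by rewrite mxE divr_ge0 ?ltW.
  rewrite sum_rank; under eq_bigr do rewrite mxE enum_rankK.
  by rewrite -mulr_suml divff // gt_eqF.
have [|||c /set_mem Ac cmin] := @compact_EVT_min _ R f A.
- by have [v Av _] := normA (fun=> 1) (fun=> ltr01); exists v.
- exact: simplex_compact.
- apply: continuous_in_subspaceT => v /set_mem Av.
  apply: cvg_fin_max => x.
  apply: (@cvgM R _ (nbhs v) _ (fun v => kfun Q (w v) x) (fun v => (w v x)^-1)).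
    exact: Kwc.
  by apply: cvgV; [rewrite gt_eqF ?wA|exact: wc].
have f_ub v : A v -> forall x, kfun Q (w v) x <= f v * w v x.
  by move=> Av x; rewrite -ler_pdivrMr ?wA //; exact: (le_bigmax _ (fun x => F x v)).
have f_lt v : A v -> (forall x, kfun Q (w v) x < f c * w v x) -> f c <= f v -> False.
  move=> Av lt /le_lt_trans; move=> /(_ (f c)); rewrite ltxx => h.
  apply/notF/h/bigmax_ltP; split=> [|x _]; last by rewrite ltr_pdivrMr ?wA.
  have := lt x0; have : 0 <= kfun Q (w v) x0 by apply: kfun_ge0 => // y; rewrite ltW ?wA.
  by move=> /le_lt_trans/[apply]; rewrite pmulr_lgt0 ?wA.
exists (f c), (w c); split=> [|x|x].
- by rewrite bigmax_ge_id.
- exact: wA.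
apply/eqP; apply: contrapT => /negP ne.
have [v Av [d d0 vE]] := normA _ (wA c Ac).
apply: (f_lt v Av); last by apply: cmin; rewrite inE.
(* The defect f(c) w - Q w at the minimizer is non-negative and not zero; [S], which commutes with
   [Q], makes it positive everywhere, so the maximum would strictly decrease. *)
move=> y; have -> : w v = fun z => d * kfun S (w c) z.
  by apply/funext => z; rewrite /w -kfunZ; apply: eq_bigr => t _; rewrite vE.
rewrite kfunZ mulrCA ltr_pM2l // QS -kfunZ -subr_gt0 -kfunB.
apply: S_pos => [z|]; first by rewrite subr_ge0 f_ub.
by exists x; rewrite subr_eq0 eq_sym.
Qed.

Lemma kfun_ktr Q f x : kfun (ktr Q) f x = mkernel f Q x.
Proof. by apply: eq_bigr => y _; rewrite mulrC. Qed.

Lemma expect_kfun Q mu f : expect mu (kfun Q f) = expect (mkernel mu Q) f.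
Proof.
rewrite /expect /kfun /mkernel; under eq_bigr do rewrite mulr_sumr.
rewrite exchange_big; apply: eq_bigr => y _ /=; rewrite mulr_suml.
by apply: eq_bigr => x _; rewrite mulrA.
Qed.

Lemma expectZ mu c (f : I -> R) : expect mu (fun x => c * f x) = c * expect mu f.
Proof. by rewrite /expect mulr_sumr; apply: eq_bigr => x _; rewrite mulrCA. Qed.

Lemma expectZl c mu (f : I -> R) : expect (fun x => c * mu x) f = c * expect mu f.
Proof. by rewrite /expect mulr_sumr; apply: eq_bigr => x _; rewrite mulrA. Qed.

(** Evaluate v Q u from both sides: it equals r v(u) and s v(u), and v(u) > 0. *)
Lemma eigenvalues_unique (x0 : I) Q (r s : R) (v u : I -> R) :
  (forall x, 0 <= v x) -> (exists x, 0 < v x) ->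
  (forall x, 0 < u x) -> (forall x, mkernel v Q x = r * v x) ->
  (forall x, kfun Q u x = s * u x) -> r = s.
Proof.
move=> v0 [z vz] u0 vE uE; have := expect_kfun Q v u.
have -> : mkernel v Q = fun x => r * v x by apply/funext.
have -> : kfun Q u = fun x => s * u x by apply/funext.
rewrite expectZ expectZl => /mulIf -> //.
rewrite gt_eqF // /expect (bigD1 z) //= ltr_wpDr ?mulr_gt0 //.
by apply: sumr_ge0 => x _; rewrite mulr_ge0 // ltW.
Qed.

(** If v(x) = 0 then Q^n v(x) = r^n v(x) = 0 for all n, against the existence of a path from x to a
    point where v > 0. *)
Lemma positive_eigenvector Q (r : R) (v : I -> R) :
  (forall x y, 0 <= Q x y) -> irreducible_kernel Q ->
  (forall x, 0 <= v x) -> (exists x, 0 < v x) ->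
  (forall x, kfun Q v x = r * v x) -> forall x, 0 < v x.
Proof.
move=> Q0 irr v0 [y vy] vE x; have [n xy] := irr x y.
have : kfun (kpow Q n) v x = r ^+ n * v x.
  elim: n {xy} x => [|n IH] x; first by rewrite kfun_kpow0 mul1r.
  rewrite kfun_kpowS; have -> : kfun (kpow Q n) v = fun x => r ^+ n * v x by apply/funext.
  by rewrite kfunZ vE exprSr mulrA.
rewrite lt_neqAle v0 andbT eq_sym => vx; apply/eqP => vx0; move: vx.
rewrite vx0 mulr0 => /eqP; rewrite gt_eqF // /kfun (bigD1 y) //=.
rewrite ltr_wpDr ?mulr_gt0 // sumr_ge0 // => z _.
by rewrite mulr_ge0 // kpow_ge0.
Qed.

(** [eigenvalue] refers to row vectors, hence the left eigenvector. For a complex eigenpair (l, z),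
    evaluate z Q = l z at a point where |z| / v is maximal: the triangle inequality gives |l| <= r,
    and [v] itself attains r. *)
Lemma spectral_radiusE (x0 : I) Q (r : R) (v : I -> R) :
  (forall x y, 0 <= Q x y) -> 0 <= r -> (forall x, 0 < v x) ->
  (forall x, mkernel v Q x = r * v x) -> spectral_radius Q = r.
Proof.
move=> Q0 r0 v0 vE; rewrite /spectral_radius; set L := [set _ | _].
have Lr : L r.
  exists (real_complex R r); last by rewrite /= expr0n addr0 sqrtr_sqr ger0_norm.
  apply/eigenvalueP; exists (\row_j real_complex R (v (enum_val j))).
    apply/rowP => j; rewrite !mxE -rmorphM -vE /mkernel rmorph_sum /=.
    rewrite [RHS](reindex (@enum_val I [in I])) /=; last first.
      by exists enum_rank => ? _; [exact: enum_valK|exact: enum_rankK].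
    by apply: eq_bigr => i _; rewrite !mxE rmorphM.
  apply/eqP => /rowP/(_ (enum_rank x0)); rewrite !mxE enum_rankK => /eqP.
  by rewrite fmorph_eq0 gt_eqF.
have ubL : ubound L r.
  move=> _ [l /eigenvalueP[z zE z_neq0] ->].
  pose a x := ComplexField.Normc.normc (z ord0 (enum_rank x)) / v x.
  case: (@arg_maxP _ _ I x0 xpredT a) => // x _ xmax.
  have ax0 : 0 < a x.
    have [i zi] : exists i, z ord0 i != 0.
      apply: contrapT => /forallNP h; case/eqP: z_neq0; apply/rowP => i.
      by rewrite mxE; apply/eqP; move/negP: (h i); rewrite negbK.
    apply: lt_le_trans (xmax (enum_val i) isT).
    rewrite /a enum_valK divr_gt0 // lt_neqAle eq_sym.
    have -> /= : 0 <= ComplexField.Normc.normc (z ord0 i).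
      by case: (z _ _) => ? ?; exact: sqrtr_ge0.
    rewrite andbT.
    by apply: contraNneq zi => /ComplexField.Normc.eq0_normc ->.
  have anE y : ComplexField.Normc.normc (z ord0 (enum_rank y)) = a y * v y.
    by rewrite /a divfK // gt_eqF.
  have := congr1 (fun M : 'rV[R[i]]_#|I| =>
    ComplexField.Normc.normc (M ord0 (enum_rank x))) zE.
  rewrite !mxE ComplexField.Normc.normcM anE => E.
  suff : ComplexField.Normc.normc l * (a x * v x) <= r * (a x * v x).
    by rewrite (ler_pM2r (mulr_gt0 ax0 (v0 x))).
  rewrite -E [leRHS]mulrCA -vE /mkernel mulr_sumr.
  rewrite (reindex (@enum_rank I)) /=; last first.
    by exists enum_val => ? _; [exact: enum_rankK|exact: enum_valK].
  have normc_sum (g : I -> R[i]) : ComplexField.Normc.normc (\sum_y g y)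
      <= \sum_y ComplexField.Normc.normc (g y).
    elim/big_ind2: _ => [|a1 b1 a2 b2 h1 h2|//].
      by rewrite ComplexField.Normc.normc0.
    by rewrite (le_trans (le_normcD _ _)) // lerD.
  rewrite (le_trans (normc_sum _)) //; apply: ler_sum => y _.
  rewrite ComplexField.Normc.normcM !mxE !enum_rankK anE mulrA.
  rewrite [ComplexField.Normc.normc (real_complex _ _)]/= expr0n addr0 sqrtr_sqr.
  rewrite ger0_norm // ler_wpM2r // ler_wpM2r ?(ltW (v0 y)) //; exact: (xmax y isT).
apply/le_anti/andP; split; first by apply: ge_sup => //; exists r.
by apply: ub_le_sup => //; exists r.
Qed.

(** Apply [perron_right] to [Q] and to its transpose; pairing the two eigenvectors shows that their
    eigenvalues agree. *)
Lemma perron_frobenius (x0 : I) Q :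
  (forall x y, 0 <= Q x y) -> irreducible_kernel Q ->
  exists r u v, [/\ 0 <= r, forall x : I, 0 < u x, forall x : I, 0 < v x &
    [/\ forall x, kfun Q u x = r * u x, forall x, mkernel v Q x = r * v x
      & spectral_radius Q = r]].
Proof.
move=> Q0 irr; have [r [u [r0 u0 uE]]] := perron_right x0 Q0 irr.
have [s [v [s0 v0 vE]]] :=
  perron_right x0 (fun x y => Q0 y x : 0 <= ktr Q x y) (irreducible_ktr irr).
have {}vE x : mkernel v Q x = s * v x by rewrite -kfun_ktr.
have sr : s = r.
  by apply: (eigenvalues_unique x0 _ _ u0 vE uE) => [x|]; [exact: ltW|exists x0].
exists r, u, v; split=> //; split=> // [x|]; first by rewrite vE sr.
by rewrite -sr; apply: (spectral_radiusE x0 Q0 s0 v0).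
Qed.

End PerronFrobenius.

(** * Green functions *)

Section Green.
Variables (R : realType) (I : finType) (Q : I -> I -> R) (w : I -> R) (rho : R).
Hypotheses (Q_ge0 : forall x y, 0 <= Q x y) (w_gt0 : forall x, 0 < w x)
  (rho_lt1 : rho < 1) (Qw : forall x, kfun Q w x <= rho * w x).

(** The weighted norm satisfies |v|(w) <= |v|(Q w) <= rho |v|(w) with rho < 1, so it is zero. This
    is the injectivity of I - Q. *)
Lemma subinvariant_eq0 (v : I -> R) :
  (forall y, v y = mkernel v Q y) -> forall y, v y = 0.
Proof.
move=> vQ y; have r1 := rho_lt1.
have h1 : expect (fun x => `|v x|) w <= rho * expect (fun x => `|v x|) w.
  rewrite -expectZ; apply: (@le_trans _ _ (expect (fun x => `|v x|) (kfun Q w))).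
    rewrite expect_kfun; apply: ler_sum => x _; rewrite ler_wpM2r ?(ltW (w_gt0 x)) //.
    rewrite {1}vQ (le_trans (ler_norm_sum _ _ _)) //; apply: ler_sum => z _.
    by rewrite normrM [`|Q z x|]ger0_norm.
  by apply: ler_sum => x _; rewrite ler_wpM2l.
have e0 : 0 <= expect (fun x => `|v x|) w.
  by apply: sumr_ge0 => x _; rewrite mulr_ge0 // ltW.
have : expect (fun x => `|v x|) w = 0 by nra.
move/eqP; rewrite psumr_eq0; last by move=> x _; rewrite mulr_ge0 // ltW.
move/allP/(_ y (mem_index_enum y)) => /=.
by rewrite mulf_eq0 (gt_eqF (w_gt0 y)) orbF normr_eq0 => /eqP.
Qed.

(** Let c be the minimum of f / w, attained at z. If c < 0 then c w(z) = f(z) >= Q f(z) >= c Q w(z)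
    >= c rho w(z), which contradicts rho < 1. *)
Lemma minimum_principle f : (forall x, kfun Q f x <= f x) -> forall x, 0 <= f x.
Proof.
move=> Qf x; have r1 := rho_lt1.
case: (@arg_minP _ _ I x xpredT (fun z => f z / w z)) => // z _ zmin.
have fw y : f z / w z * w y <= f y by rewrite -ler_pdivlMr //; exact: (zmin y isT).
set c := f z / w z in fw.
have [c0|c0] := leP 0 c; first by rewrite (le_trans _ (fw x)) // mulr_ge0 // ltW.
have : c * w z >= c * rho * w z.
  have -> : c * w z = f z by rewrite /c divfK // gt_eqF.
  apply: le_trans (Qf z); apply: (@le_trans _ _ (c * kfun Q w z)).
    by rewrite -mulrA ler_wnM2l // ltW.
  by rewrite -kfunZ; exact: kfun_le.
rewrite ler_pM2r //; nra.
Qed.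

(** G is the inverse of I - Q: [subinvariant_eq0] gives invertibility, [minimum_principle] applied
    to the columns gives the sign, and the powers are dominated by induction on G = I + Q G. *)
Lemma green_exists : exists G : I -> I -> R, [/\ forall x y, 0 <= G x y,
  forall x y, G x y = (x == y)%:R + \sum_z Q x z * G z y,
  forall x y, G x y = (x == y)%:R + \sum_z G x z * Q z y &
  forall n x y, kpow Q n x y <= G x y].
Proof.
pose A := kernel_mx Q; pose M := 1%:M - A.
have sumE (g : 'I_#|I| -> R) : \sum_i g i = \sum_(x : I) g (enum_rank x).
  by rewrite (reindex (@enum_rank I)) //; exists enum_val => ? _;
    [exact: enum_rankK|exact: enum_valK].
have uM : M \in unitmx.
  rewrite -row_free_unit; apply: inj_row_free => v; rewrite mulmxBr mulmx1 => /eqP.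
  rewrite subr_eq0 => /eqP vA.
  have z0 : forall y, v ord0 (enum_rank y) = 0.
    apply: subinvariant_eq0 => y; rewrite {1}vA mxE sumE.
    by apply: eq_bigr => x _; rewrite mxE !enum_rankK.
  by apply/rowP => i; rewrite mxE -(enum_valK i) z0.
pose N := invmx M; pose G x y := N (enum_rank x) (enum_rank y).
have GE x y : G x y = (x == y)%:R + \sum_z Q x z * G z y.
  have : N = 1%:M + A *m N.
    by rewrite -[1%:M](mulmxV uM) -/N /M mulmxBl mul1mx subrK.
  move/matrixP/(_ (enum_rank x) (enum_rank y)).
  rewrite !mxE sumE -/(G x y) (inj_eq enum_rank_inj) => ->; congr (_ + _).
  by apply: eq_bigr => z _; rewrite mxE !enum_rankK.
have GE' x y : G x y = (x == y)%:R + \sum_z G x z * Q z y.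
  have : N = 1%:M + N *m A.
    by rewrite -[1%:M](mulVmx uM) -/N /M mulmxBr mulmx1 subrK.
  move/matrixP/(_ (enum_rank x) (enum_rank y)).
  rewrite !mxE sumE -/(G x y) (inj_eq enum_rank_inj) => ->; congr (_ + _).
  by apply: eq_bigr => z _; rewrite mxE !enum_rankK.
have G0 x y : 0 <= G x y.
  apply: (minimum_principle (f := fun z => G z y)) => z.
  by rewrite [leRHS]GE lerDr.
exists G; split=> // n x y; elim: n x => [|n IH] x.
  by rewrite GE /= lerDl; apply: sumr_ge0 => z _; rewrite mulr_ge0.
rewrite GE /=; apply: ler_wpDl => //.
by apply: ler_sum => z _; rewrite ler_wpM2l.
Qed.

End Green.

Section RightGreen.
Variables (R : realType) (I : finType) (Q G : I -> I -> R).

Lemma kfun_green f x : (forall x y, G x y = (x == y)%:R + \sum_z G x z * Q z y) ->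
  kfun G f x = f x + kfun G (kfun Q f) x.
Proof.
move=> GE; rewrite {1}/kfun; under eq_bigr do rewrite GE mulrDl.
rewrite big_split /= sum_delta; congr (_ + _); rewrite /kfun.
under eq_bigr do rewrite mulr_suml; under [RHS]eq_bigr do rewrite mulr_sumr.
by rewrite exchange_big; do 2!apply: eq_bigr => ? _; rewrite mulrA.
Qed.

Lemma mkernel_green m y : (forall x y, G x y = (x == y)%:R + \sum_z Q x z * G z y) ->
  mkernel m G y = m y + mkernel (mkernel m Q) G y.
Proof.
move=> GE; rewrite {1}/mkernel; under eq_bigr do rewrite GE mulrDr.
rewrite big_split /=; congr (_ + _).
  rewrite -(sum_delta y m); apply: eq_bigr => x _.
  by rewrite mulrC eq_sym.
rewrite /mkernel; under eq_bigr do rewrite mulr_sumr.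
under [RHS]eq_bigr do rewrite mulr_suml.
by rewrite exchange_big; do 2!apply: eq_bigr => ? _; rewrite mulrA.
Qed.

End RightGreen.

(** * Vanishing of noisy Lyapunov functions *)

Section Descent.
Variable R : realType.
Implicit Types (V a b : nat -> R).

(** Each drop lowers [V] by at least [k], so finitely many windows bring it below 2 e / 3. From
    there a window climbs by at most e / 3 and ends below 2 e / 3 again, so [V] stays below e. *)
Lemma descent_cvg0 V : (forall n, 0 <= V n) ->
  (forall eps, 0 < eps -> exists2 k, 0 < k & exists N, forall n, (N <= n)%N ->
     exists m, [/\ (n < m)%N,
       forall j, (n <= j <= m)%N -> V j <= V n + eps
       & eps <= V n -> V m <= V n - k]) ->
  V @ \oo --> 0.
Proof.
move=> V0 H; apply/cvgr0Pnorm_le => e e0.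
have [k k0 [N step]] := H (e / 3) ltac:(by rewrite divr_gt0).
(* Induction on a bound [i] for the number of drops that can still occur. *)
have low (i : nat) n : (N <= n)%N -> V n <= i%:R * k ->
    exists2 m, (N <= m)%N & V m <= e / 3 * 2.
  elim: i n => [|i IH] n Nn Vn.
    by exists n => //; rewrite (le_trans Vn) // mul0r; lra.
  have [m [nm _ drop]] := step n Nn.
  case: (leP (e / 3) (V n)) => [/drop Vm|lt]; last by exists n => //; lra.
  apply: (IH m); first exact: leq_trans Nn (ltnW nm).
  by move: Vn; rewrite -natr1 mulrDl mul1r; lra.
have [n0 Nn0 Vn0] : exists2 m, (N <= m)%N & V m <= e / 3 * 2.
  apply: (low (Num.truncn (V N / k)).+1 N) => //.
  by rewrite -ler_pdivrMr // ltW // truncnS_gt.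
(* Induction on a bound [d] for the time left until [j]. *)
have stay d n j : (N <= n)%N -> V n <= e / 3 * 2 -> (n <= j)%N -> (j - n <= d)%N ->
    V j <= e.
  elim: d n => [|d IH] n Nn Vn nj jd.
    have -> : j = n by apply/eqP; rewrite eqn_leq nj -subn_eq0 -leqn0 jd.
    by lra.
  have [m [nm win drop]] := step n Nn.
  have [jm|mj] := leqP j m.
    by have := win j; rewrite nj jm => /(_ isT); lra.
  apply: (IH m); [exact: leq_trans Nn (ltnW nm)| |exact: ltnW| ].
  - case: (leP (e / 3) (V n)) => [/drop|lt]; first by lra.
    by have := win m; rewrite (ltnW nm) leqnn => /(_ isT); lra.
  - by move: jd nm mj => /=; rewrite !leq_subLR => jd nm mj; lia.
near=> n; rewrite ger0_norm //; apply: (stay (n - n0)%N n0) => //.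
by near: n; exists n0.
Unshelve. all: by end_near. Qed.

Lemma ratio_drop (a b a' b' d M : R) : 0 < b -> 0 < b' -> b' <= M -> 0 <= d ->
  a' * b - a * b' <= - d * b -> a' / b' <= a / b - d / M.
Proof.
move=> b0 b'0 b'M d0 H; have M0 : 0 < M by lra.
have -> : a' / b' = a / b + (a' * b - a * b') / (b * b').
  by field; rewrite !gt_eqF.
have dM : d / M * b' <= d by rewrite mulrAC ler_pdivrMr // ler_wpM2l.
rewrite lerD2l ler_pdivrMr ?mulr_gt0 // (le_trans H) //.
rewrite !mulNr lerN2 mulrCA mulrC ler_wpM2r //; exact: ltW.
Qed.

Lemma ratio_window (a b a' b' d c K : R) : 0 < c -> 0 <= K -> 0 <= a -> a <= K * b ->
  c <= b -> c <= b' -> `|a' - a| <= d -> `|b' - b| <= d ->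
  a' / b' <= a / b + (1 + K) * d / c.
Proof.
move=> c0 K0 a0 aK cb cb' ha hb.
have b0 : 0 < b by lra.
have b'0 : 0 < b' by lra.
have d0 : 0 <= d by apply: le_trans ha.
have -> : a' / b' = a / b + ((a' - a) + a / b * (b - b')) / b'.
  by field; rewrite !gt_eqF.
rewrite lerD2l ler_pdivrMr //.
have h1 : (1 + K) * d <= (1 + K) * d / c * b'.
  rewrite mulrAC -mulrA ler_peMr ?mulr_ge0 ?addr_ge0 //.
  by rewrite ler_pdivlMr ?mul1r.
apply: le_trans h1; rewrite mulrDl mul1r lerD //.
  by rewrite (le_trans (ler_norm _)).
rewrite (le_trans (ler_norm _)) // normrM distrC ler_pM //.
by rewrite ger0_norm ?divr_ge0 ?ler_pdivrMr // ltW.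
Qed.

(** The decrease is measured on the determinant a_m b_n - a_n b_m, in which a growth factor common
    to both sequences cancels. The gain rho T beats the error B T^2 once T is small. *)
Lemma ratio_descent a b (c M K : R) : 0 < c -> 0 <= K ->
  (forall n, 0 <= a n) -> (forall n, 0 <= b n) ->
  (exists N, forall n, (N <= n)%N -> [/\ a n <= K * b n, c <= b n & b n <= M]) ->
  (forall eps, 0 < eps -> exists B rho, [/\ 0 < B, 0 < rho &
     forall T0, 0 < T0 -> exists2 T, 0 < T <= T0 &
     exists N, forall n, (N <= n)%N -> exists m, [/\ (n < m)%N,
       forall j, (n <= j <= m)%N -> `|a j - a n| <= B * T /\ `|b j - b n| <= B * T
     & eps * b n <= a n ->
         a m * b n - a n * b m <= (B * T ^+ 2 - rho * T) * b n]]) ->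
  (fun n => a n / b n) @ \oo --> 0.
Proof.
move=> c0 K0 a0 b0 [N0 bnd] H; apply: descent_cvg0 => [n|eps eps0].
  by rewrite divr_ge0.
have M0 : 0 < M by have [_] := bnd N0 (leqnn _); lra.
have [B [rho [B0 rho0 step]]] := H eps eps0.
(* The first bound on [T] leaves at least half of the gain; the second keeps the rise of the ratio
   within a window below [eps]. *)
have T00 : 0 < Num.min (rho / (2 * B)) (eps * c / ((1 + K) * B)).
  by rewrite !lt_min !divr_gt0 ?mulr_gt0 //= ltr_wpDr.
have [T /andP[T_gt0 +] [N1 stepT]] := step _ T00.
rewrite le_min => /andP[T1 T2].
have Trho : B * T <= rho / 2.
  by move: T1; rewrite ler_pdivlMr ?mulr_gt0 //; lra.
have Teps : (1 + K) * (B * T) / c <= eps.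
  move: T2; rewrite ler_pdivlMr ?mulr_gt0 ?ltr_wpDr // ler_pdivrMr //.
  by rewrite mulrC -mulrA.
exists (rho / 2 * T / M); first by rewrite !divr_gt0 ?mulr_gt0 // divr_gt0.
exists (maxn N0 N1) => n; rewrite geq_max => /andP[n0 n1].
have [m [nm win drop]] := stepT n n1; exists m.
have [aK cb bM] := bnd n n0.
split=> // [j /andP[nj jm]|epsV].
- have [_ cbj _] := bnd j (leq_trans n0 nj).
  have [ha hb] := win j ltac:(by rewrite nj jm).
  rewrite (le_trans (ratio_window c0 K0 (a0 n) aK cb cbj ha hb)) //.
  by rewrite lerD2l.
- have [_ cbm bmM] := bnd m (leq_trans n0 (ltnW nm)).
  apply: ratio_drop => //; [lra|lra|by rewrite ltW // mulr_gt0 // divr_gt0|].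
  apply: le_trans (drop _) _.
    by rewrite -ler_pdivlMr //; lra.
  apply: ler_wpM2r => //; rewrite expr2 mulrA.
  have : B * T * T <= rho / 2 * T by rewrite ler_wpM2r // ltW.
  by lra.
Qed.

End Descent.

(** * Convergence of perturbed Euler schemes *)

Section Attractor.
Variables (R : realType) (E : finType).
Variables (G : E -> E -> R) (u h pi : E -> R) (th c C kp c0 : R).
Hypotheses (G_ge0 : forall x y, 0 <= G x y)
  (u_ge0 : forall x, 0 <= u x) (h_ge0 : forall x, 0 <= h x)
  (c0_gt0 : 0 < c0) (uh_ge : forall x, c0 <= u x + h x)
  (c_gt0 : 0 < c) (C_ge0 : 0 <= C) (kp_gt0 : 0 < kp)
  (Gu_le : forall x, kfun G u x <= th * u x)
  (Gh_ge : forall x, th * h x + c * u x <= kfun G h x)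
  (Gh_le : forall x, kfun G h x <= th * h x + C * u x)
  (piG : forall y, mkernel pi G y = th * pi y)
  (minor : forall x y, kp * h x * pi y <= G x y)
  (pi_prob : is_prob pi) (pih : expect pi h = 1)
  (piu : forall x, pi x * u x = 0).
Variable mu : nat -> E -> R.
Hypothesis mu_prob : forall n, is_prob (mu n).

(** [B] is chosen before the window length, so the error is O(T^2) uniformly as [T] tends to 0. The
    multiplier [A] stands for the integral of the scalar control over the window. *)
Definition euler_windows := exists2 B : R, 0 < B &
  forall T0 : R, 0 < T0 -> exists2 T, 0 < T <= T0 &
  exists N, forall n, (N <= n)%N -> exists m (t A : R), [/\ (n < m)%N, T <= t /\ t <= 2 * T, 0 <= A /\ A <= t,
    forall y, `|mu m y - ((1 - t) * mu n y + A * mkernel (mu n) G y)| <= B * T ^+ 2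
  & forall j, (n <= j <= m)%N -> forall y, `|mu j y - mu n y| <= B * T].

Let L1 (f : E -> R) : R := \sum_y `|f y|.
(** [mm] and [ss] are the masses seen by [u] and [h]; [phi] is the deviation from the multiple of
    [pi] with the same h-mass, and [DD] is its l^1 norm weighted by [h]. *)
Let mm n := expect (mu n) u.
Let ss n := expect (mu n) h.
Let phi n y := mu n y - ss n * pi y.
Let DD n := \sum_y `|phi n y| * h y.

Lemma norm_expect_le (e f : E -> R) (d : R) :
  (forall y, `|e y| <= d) -> `|expect e f| <= L1 f * d.
Proof.
move=> ed; rewrite (le_trans (ler_norm_sum _ _ _)) // mulr_suml.
by apply: ler_sum => y _; rewrite normrM mulrC ler_wpM2l.
Qed.

Lemma expect_ge0 (m f : E -> R) : (forall y, 0 <= m y) -> (forall y, 0 <= f y) ->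
  0 <= expect m f.
Proof. by move=> m0 f0; apply: sumr_ge0 => y _; rewrite mulr_ge0. Qed.

Lemma expect_ler (m f g : E -> R) : (forall y, 0 <= m y) ->
  (forall y, f y <= g y) -> expect m f <= expect m g.
Proof. by move=> m0 fg; apply: ler_sum => y _; rewrite ler_wpM2l. Qed.

Lemma expectD (m f g : E -> R) :
  expect m (fun y => f y + g y) = expect m f + expect m g.
Proof. by rewrite -big_split; apply: eq_bigr => y _; rewrite mulrDr. Qed.

Lemma expect_euler (m' m f : E -> R) t A :
  expect m' f - ((1 - t) * expect m f + A * expect m (kfun G f)) =
  expect (fun y => m' y - ((1 - t) * m y + A * mkernel m G y)) f.
Proof.
rewrite expect_kfun /expect !mulr_sumr -big_split -sumrB /=.
by apply: eq_bigr => y _; ring.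
Qed.

Lemma expectBl (m m' f : E -> R) :
  expect m f - expect m' f = expect (fun y => m y - m' y) f.
Proof. by rewrite -sumrB; apply: eq_bigr => y _; rewrite mulrBl. Qed.

Lemma expect_phi n : expect (phi n) h = 0.
Proof.
by rewrite -expectBl [X in _ - X]expectZl pih mulr1 subrr.
Qed.

(** [pi] vanishes wherever [u] does not, so [u] does not see the subtracted multiple of [pi]. *)
Lemma sum_phi_u n : \sum_y `|phi n y| * u y = mm n.
Proof.
apply: eq_bigr => y _; rewrite -{1}(ger0_norm (u_ge0 y)) -normrM /phi mulrBl.
rewrite -mulrA piu mulr0 subr0 ger0_norm // mulr_ge0 //.
by have [+ _] := mu_prob n; apply.
Qed.

Lemma mu_ge0 n y : 0 <= mu n y. Proof. by have [+ _] := mu_prob n; apply. Qed.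

Lemma mm_ge0 n : 0 <= mm n. Proof. exact/expect_ge0/u_ge0/mu_ge0. Qed.

Lemma ss_ge0 n : 0 <= ss n. Proof. exact/expect_ge0/h_ge0/mu_ge0. Qed.

Lemma DD_ge0 n : 0 <= DD n.
Proof. by apply: sumr_ge0 => y _; rewrite mulr_ge0. Qed.

Lemma ms_ge n : c0 <= mm n + ss n.
Proof.
rewrite -expectD -[c0]mulr1; have [_ <-] := mu_prob n; rewrite mulr_sumr.
by apply: ler_sum => y _; rewrite mulrC ler_wpM2l ?mu_ge0.
Qed.

Lemma DD_le n : DD n <= 2 * ss n.
Proof.
have -> : 2 * ss n = \sum_y (mu n y + ss n * pi y) * h y.
  under eq_bigr do rewrite mulrDl -mulrA.
  by rewrite big_split /= -mulr_sumr -!/(expect _ _) pih; rewrite /ss; ring.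
apply: ler_sum => y _; rewrite ler_wpM2r // (le_trans (ler_normB _ _)) //.
rewrite !ger0_norm ?mu_ge0 // mulr_ge0 ?ss_ge0 //.
by have [+ _] := pi_prob; apply.
Qed.

Lemma expect_le_L1 n f : expect (mu n) f <= L1 f.
Proof.
rewrite -[leRHS]mulr1 (le_trans (ler_norm _)) // norm_expect_le // => y.
rewrite ger0_norm ?mu_ge0 //; have [_ <-] := mu_prob n.
by rewrite (bigD1 y) //= lerDl sumr_ge0 // => z _; exact: mu_ge0.
Qed.

Lemma L1_ge0 f : 0 <= L1 f. Proof. exact: sumr_ge0. Qed.

(* With [phi = mu - s pi] orthogonal to h, subtracting kp h(x) pi(y) from G
   does not change phi G but lowers its l^1(h) norm by kp. *)
Lemma DD_step n m t A d : 0 <= t -> t <= 1 -> 0 <= A -> 0 <= d ->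
  (forall y, `|mu m y - ((1 - t) * mu n y + A * mkernel (mu n) G y)| <= d) ->
  DD m <= (1 - t + A * th - A * kp) * DD n + 2 * A * C * mm n + 2 * L1 h * d.
Proof.
move=> t0 t1 A0 d0 err.
pose e y := mu m y - ((1 - t) * mu n y + A * mkernel (mu n) G y).
have eh : `|expect e h| <= L1 h * d by exact: norm_expect_le.
(* The h-mass gained beyond the factor [th]; it lies between 0 and C times the u-mass. *)
pose eta := expect (mu n) (kfun G h) - th * ss n.
have eta0 : 0 <= eta.
  rewrite subr_ge0 -expectZ; apply: expect_ler => y; first exact: mu_ge0.
  by apply: le_trans (Gh_ge y); rewrite lerDl mulr_ge0 // ltW.
have etaC : eta <= C * mm n.
  by rewrite lerBlDl -!expectZ -expectD; apply: expect_ler => y; first exact: mu_ge0.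
have phiG y : mkernel (phi n) G y = mkernel (mu n) G y - ss n * (th * pi y).
  rewrite -piG mulr_sumr -sumrB; apply: eq_bigr => x _; rewrite /phi; ring.
have ssE : ss m = (1 - t) * ss n + A * (th * ss n + eta) + expect e h.
  have -> : th * ss n + eta = expect (mu n) (kfun G h) by rewrite /eta; ring.
  by rewrite -expect_euler -/(ss m) -/(ss n); ring.
have phiE y : phi m y =
    (1 - t) * phi n y + A * mkernel (phi n) G y + e y - (A * eta + expect e h) * pi y.
  by rewrite phiG /phi ssE /e; ring.
have pi0 y : 0 <= pi y by have [+ _] := pi_prob; apply.
have phiG_le y : `|mkernel (phi n) G y| <=
    \sum_x `|phi n x| * (G x y - kp * h x * pi y).
  have -> : mkernel (phi n) G y = \sum_x phi n x * (G x y - kp * h x * pi y).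
    under [RHS]eq_bigr do rewrite mulrBr.
    rewrite sumrB [X in _ - X](_ : _ = 0) ?subr0 //.
    transitivity (kp * pi y * expect (phi n) h); last by rewrite expect_phi mulr0.
    by rewrite mulr_sumr; apply: eq_bigr => x _; ring.
  rewrite (le_trans (ler_norm_sum _ _ _)) //; apply: ler_sum => x _.
  by rewrite normrM [X in _ * X]ger0_norm // subr_ge0.
have sum_phiG : \sum_y `|mkernel (phi n) G y| * h y <= (th - kp) * DD n + C * mm n.
  apply: (@le_trans _ _ (\sum_x `|phi n x| * (kfun G h x - kp * h x))).
    apply: le_trans (ler_sum _ (fun y _ => ler_wpM2r (h_ge0 y) (phiG_le y))) _.
    rewrite le_eqVlt; apply/orP; left; apply/eqP.
    under eq_bigr do rewrite mulr_suml.
    rewrite exchange_big; apply: eq_bigr => x _ /=.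
    transitivity (`|phi n x| * (kfun G h x - kp * h x * expect pi h)); last first.
      by rewrite pih mulr1.
    rewrite /kfun /expect mulr_sumr -sumrB mulr_sumr.
    by apply: eq_bigr => y _; ring.
  rewrite -(sum_phi_u n) /DD !mulr_sumr -big_split /=; apply: ler_sum => x _.
  have -> : (th - kp) * (`|phi n x| * h x) + C * (`|phi n x| * u x) =
    `|phi n x| * (th * h x + C * u x - kp * h x) by ring.
  by rewrite ler_wpM2l // lerB.
have h1 : DD m <= (1 - t) * DD n + A * (\sum_y `|mkernel (phi n) G y| * h y)
    + (L1 h * d + (A * eta + L1 h * d)).
  have -> : L1 h * d + (A * eta + L1 h * d) =
      \sum_y (d * `|h y| + (A * eta + L1 h * d) * (pi y * h y)).
    rewrite big_split /= -!mulr_sumr -/(expect pi h) pih mulr1 -/(L1 h); ring.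
  rewrite /DD !mulr_sumr -!big_split /=; apply: ler_sum => y _; rewrite phiE.
  rewrite (ger0_norm (h_ge0 y)) !mulrA -!mulrDl ler_wpM2r //.
  rewrite (le_trans (ler_normB _ _)) // [leRHS]addrA.
  apply: lerD; last first.
    rewrite normrM (ger0_norm (pi0 y)) ler_wpM2r // (le_trans (ler_normD _ _)) //.
    by rewrite ger0_norm ?mulr_ge0 // lerD2l.
  rewrite (le_trans (ler_normD _ _)) //; apply: lerD; last exact: err.
  rewrite (le_trans (ler_normD _ _)) // !normrM (ger0_norm A0).
  by rewrite ger0_norm // subr_ge0.
apply: le_trans h1 _.
have := ler_wpM2l A0 sum_phiG; have := ler_wpM2l A0 etaC.
by nra.
Qed.

Lemma DD_window n j d : (forall y, `|mu j y - mu n y| <= d) ->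
  `|DD j - DD n| <= 2 * L1 h * d.
Proof.
move=> jn; have sd : `|ss j - ss n| <= L1 h * d by rewrite expectBl norm_expect_le.
have pi0 y : 0 <= pi y by have [+ _] := pi_prob; apply.
rewrite -sumrB (le_trans (ler_norm_sum _ _ _)) //.
have -> : 2 * L1 h * d = \sum_y (d * `|h y| + L1 h * d * (pi y * h y)).
  rewrite big_split /= -!mulr_sumr -/(expect pi h) pih -/(L1 h); ring.
apply: ler_sum => y _; rewrite -mulrBl normrM (ger0_norm (h_ge0 y)) mulrA -mulrDl.
rewrite ler_wpM2r // (le_trans (ler_dist_dist _ _)) //.
have -> : phi j y - phi n y = (mu j y - mu n y) - (ss j - ss n) * pi y.
  by rewrite /phi; ring.
rewrite (le_trans (ler_normB _ _)) // lerD // normrM (ger0_norm (pi0 y)).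
by rewrite ler_wpM2r.
Qed.

Hypothesis euler : euler_windows.

(** All three scalars carry the same factor [l], equal to 1 - t + A th, which will cancel in ratios.
    Testing the Euler step against the constant 1 bounds [A] from below by a multiple of [T]. *)
Lemma scalar_windows : exists2 M : R, 0 < M &
  forall T0 : R, 0 < T0 -> exists2 T, 0 < T <= T0 &
  exists N, forall n, (N <= n)%N ->
  exists m l A, [/\ (n < m)%N, T / M <= A /\ A <= 2 * T,
    mm m <= l * mm n + M * T ^+ 2 /\ l * ss n + A * c * mm n - M * T ^+ 2 <= ss m,
    DD m <= (l - A * kp) * DD n + M * T * mm n + M * T ^+ 2
  & forall j, (n <= j <= m)%N -> [/\ `|mm j - mm n| <= M * T,
      `|ss j - ss n| <= M * T & `|DD j - DD n| <= M * T]].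
Proof.
have C_nneg := C_ge0.
have [B B0 win] := euler.
pose g1 := kfun G (@Defs.one R E).
have Lu := L1_ge0 u; have Lh := L1_ge0 h; have L1' := L1_ge0 (@Defs.one R E).
have Lg := L1_ge0 g1.
have [M0 M00 M0g] : exists2 M0 : R, 1 <= M0 & L1 g1 <= M0.
  by exists (1 + L1 g1); rewrite ?lerDl ?lerDr.
have [Q [Q1 Qu Qh Q1']] : exists Q : R,
    [/\ 1 <= Q, L1 u <= Q, 2 * L1 h <= Q & L1 (@Defs.one R E) <= Q].
  by exists (1 + L1 u + 2 * L1 h + L1 (@Defs.one R E)); split; lra.
have Q0 : 0 < Q by lra.
have Qh' : L1 h <= Q by lra.
have BQ0 : 0 < B * Q by rewrite mulr_gt0 //; lra.
have [M [Mgt0 MBQ MM0 MC]] : exists M : R,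
    [/\ 0 < M, B * Q <= M, 2 * M0 <= M & 4 * C <= M].
  by exists (B * Q + 2 * M0 + 4 * C); split; lra.
exists M => // T0 T00.
(* T <= 1/2 ensures t <= 1, and T <= 1 / (2 B Q) keeps the Euler error below T / 2. *)
have T10 : 0 < Num.min T0 (Num.min (2^-1) (2 * (B * Q))^-1).
  by rewrite !lt_min T00 !invr_gt0 ltr0n /=; lra.
have [T /andP[T_gt0 +] [N step]] := win _ T10.
rewrite !le_min => /and3P[TT0 Thalf TBQ].
exists T; first by rewrite T_gt0.
exists N => n Nn.
have [m [t [A [nm [tT t2T] [A0 At] err wnd]]]] := step n Nn.
have BT0 : 0 <= B * T ^+ 2 by rewrite mulr_ge0 ?sqr_ge0 // ltW.
have BQT : B * T ^+ 2 * Q <= T / 2.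
  move: TBQ; rewrite -[leRHS]mul1r ler_pdivlMr ?mulr_gt0 // => TBQ.
  by rewrite expr2; nra.
have MT2 : B * T ^+ 2 * Q <= M * T ^+ 2.
  by rewrite mulrAC ler_wpM2r ?sqr_ge0.
have erru := norm_expect_le u err; have errh := norm_expect_le h err.
have err1 := norm_expect_le (@Defs.one R E) err.
rewrite -expect_euler in erru; rewrite -expect_euler in errh.
rewrite -expect_euler in err1.
have e1 k : expect (mu k) (@Defs.one R E) = 1.
  have [_ <-] := mu_prob k; by apply: eq_bigr => y _; rewrite mulr1.
have LQ f : L1 f <= Q -> L1 f * (B * T ^+ 2) <= B * T ^+ 2 * Q.
  by move=> fQ; rewrite mulrC ler_wpM2l.
have LuQ := LQ u Qu.
have LhQ : 2 * L1 h * (B * T ^+ 2) <= B * T ^+ 2 * Q.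
  by rewrite mulrC ler_wpM2l //; lra.
have LhT : 0 <= L1 h * (B * T ^+ 2) by rewrite mulr_ge0.
have L1Q := LQ (@Defs.one R E) Q1'.
have g1le : expect (mu n) g1 <= M0 by rewrite (le_trans (expect_le_L1 _ _)).
have AM : T / M <= A.
  rewrite ler_pdivrMr //.
  (* Both measures have mass 1, so A mu(G 1) equals t up to an error of at most T / 2. *)
  have A1 : T / 2 <= A * expect (mu n) g1.
    by move: err1; rewrite !e1 -/g1 ler_norml => /andP[]; lra.
  have : A * expect (mu n) g1 <= A * M0 by rewrite ler_wpM2l.
  have : A * (2 * M0) <= A * M by rewrite ler_wpM2l.
  by lra.
have Gum : A * expect (mu n) (kfun G u) <= A * (th * mm n).
  by rewrite ler_wpM2l // -expectZ; apply: expect_ler => // y; exact: mu_ge0.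
have Ghs : A * (th * ss n + c * mm n) <= A * expect (mu n) (kfun G h).
  rewrite ler_wpM2l // -!expectZ -expectD.
  by apply: expect_ler => // y; exact: mu_ge0.
have t0 : 0 <= t by exact: le_trans (ltW T_gt0) tT.
have t1 : t <= 1 by rewrite (le_trans t2T) // mulrC -ler_pdivlMr // mul1r.
have Dm := DD_step t0 t1 A0 BT0 err.
exists m, (1 - t + A * th), A; split=> //.
- by split=> //; exact: le_trans At t2T.
- move: erru errh; rewrite !ler_norml -!/(mm _) -!/(ss _).
  move=> /andP[_ hu] /andP[hh _]. split; lra.
- have : 2 * A * C * mm n <= M * T * mm n.
    rewrite ler_wpM2r ?mm_ge0 //.
    have CA : C * A <= C * (2 * T) by rewrite ler_wpM2l // (le_trans At).
    have CM : 4 * C * T <= M * T by rewrite ler_wpM2r // ltW.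
    by lra.
  by lra.
- move=> j jnm; have wj := wnd j jnm.
  have BT : B * T * Q <= M * T by rewrite mulrAC ler_wpM2r // ltW.
  have BT00 : 0 <= B * T by rewrite mulr_ge0 // ltW.
  have LQ' q : q <= Q -> q * (B * T) <= B * T * Q.
    by move=> fQ; rewrite mulrC ler_wpM2l.
  split.
  + by rewrite /mm expectBl (le_trans (norm_expect_le u wj)) // (le_trans _ BT) ?LQ'.
  + by rewrite /ss expectBl (le_trans (norm_expect_le h wj)) // (le_trans _ BT) ?LQ'.
  + by rewrite (le_trans (DD_window wj)) // (le_trans _ BT) ?LQ'.
Qed.

(** The term c u in the lower bound for G h feeds [ss] with a multiple of [mm], so the determinant
    of the ratio decreases by A c mm^2, up to O(T^2). *)
Lemma mm_ratio_cvg0 : (fun n => mm n / (mm n + ss n)) @ \oo --> 0.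
Proof.
have c0_pos := c0_gt0; have c_pos := c_gt0.
have [M M0 win] := scalar_windows.
have ms0 n : 0 <= mm n + ss n by rewrite addr_ge0 ?mm_ge0 ?ss_ge0.
apply: (@ratio_descent R mm _ c0 (L1 u + L1 h) 1) => //; first exact: mm_ge0.
  exists 0%N => n _; split; [|exact: ms_ge|by rewrite lerD ?expect_le_L1].
  by rewrite mul1r lerDl ss_ge0.
move=> eps eps0; exists (3 * M), (c * eps ^+ 2 * c0 / M); split=> //.
- by rewrite mulr_gt0.
- by rewrite !divr_gt0 ?mulr_gt0 // exprn_gt0.
move=> T0 /win[T TT0 [N step]]; exists T => //; exists N => n Nn.
have Tgt0 : 0 < T by case/andP: TT0.
have [m [l [A [nm [AM A2] [hm hs] _ wnd]]]] := step n Nn; exists m; split=> //.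
  move=> j /wnd[h1 h2 _]; have MT : 0 < M * T by rewrite mulr_gt0.
  split; first by lra.
  have -> : mm j + ss j - (mm n + ss n) = (mm j - mm n) + (ss j - ss n) by ring.
  by rewrite (le_trans (ler_normD _ _)) //; lra.
move=> epsm; set a := mm n in hm hs epsm *; set s := ss n in hm hs epsm *.
have a0 : 0 <= a by exact: mm_ge0.
have s0 : 0 <= s by exact: ss_ge0.
have w0 : c0 <= a + s by exact: ms_ge.
set e := M * T ^+ 2 in hm hs *.
have e0 : 0 <= e by rewrite mulr_ge0 ?sqr_ge0 // ltW.
have H1 : mm m * (a + s) - a * (mm m + ss m) <= 3 * e * (a + s) - A * c * a ^+ 2.
  have -> : mm m * (a + s) - a * (mm m + ss m) = mm m * s - a * ss m by ring.
  have := ler_wpM2r s0 hm; have := ler_wpM2l a0 hs; have := mulr_ge0 a0 e0.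
  have := mulr_ge0 s0 e0.
  by rewrite expr2; nra.
apply: le_trans H1 _.
rewrite [leRHS](_ : _ = 3 * e * (a + s) - c * eps ^+ 2 * c0 / M * T * (a + s)); last first.
  by rewrite /e; ring.
rewrite lerD2l lerN2.
(* Since a >= eps (a + s) and a + s >= c0, the quadratic gain is at least linear in a + s. *)
have a2 : eps ^+ 2 * c0 * (a + s) <= a ^+ 2.
  apply: (@le_trans _ _ ((eps * (a + s)) ^+ 2)).
    by rewrite exprMn -mulrA ler_wpM2l ?sqr_ge0 // expr2 ler_wpM2r //; lra.
  by rewrite lerXn2r ?nnegrE ?mulr_ge0 ?(ltW eps0) //; lra.
have -> : c * eps ^+ 2 * c0 / M * T * (a + s) =
    T / M * (c * (eps ^+ 2 * c0 * (a + s))) by ring.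
rewrite -[A * c * _]mulrA ler_pM //.
- by rewrite divr_ge0 // ltW.
- by rewrite !mulr_ge0 ?sqr_ge0 //; lra.
- by rewrite ler_wpM2l //; lra.
Qed.

Lemma mm_cvg0 : mm @ \oo --> 0.
Proof.
apply/cvgr0Pnorm_le => e e0; have K0 : 0 < 1 + L1 u + L1 h.
  by rewrite -addrA ltr_wpDr // addr_ge0 // L1_ge0.
have := mm_ratio_cvg0 => /cvgr0Pnorm_le /(_ (e / (1 + L1 u + L1 h))).
move=> /(_ ltac:(by rewrite divr_gt0)); apply: filterS => n.
have w0 := ms_ge n.
rewrite !ger0_norm ?mm_ge0 ?divr_ge0 ?mm_ge0 ?(le_trans _ w0) // ?(ltW c0_gt0) //.
rewrite ler_pdivrMr ?(lt_le_trans c0_gt0) // => h1; apply: le_trans h1 _.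
rewrite mulrAC ler_pdivrMr // ler_wpM2l // ?(ltW e0) //.
by have := expect_le_L1 n u; have := expect_le_L1 n h; rewrite -/(mm n) -/(ss n); lra.
Qed.

(** Once mm <= T the coupling term M T mm is itself O(T^2), and the contraction by A kp prevails.
    Since mm + ss >= c0, [ss] eventually stays above c0 / 2. *)
Lemma DD_ratio_cvg0 : (fun n => DD n / ss n) @ \oo --> 0.
Proof.
have c0_pos := c0_gt0; have c_pos := c_gt0; have kp_pos := kp_gt0.
have [M M0 win] := scalar_windows.
have mm_small e : 0 < e -> exists N, forall n, (N <= n)%N -> mm n <= e.
  move=> e0; have /cvgr0Pnorm_le/(_ e e0)[N _ HN] := mm_cvg0.
  by exists N => n /HN /=; rewrite ger0_norm ?mm_ge0.
have [N1 mmc] := mm_small (c0 / 2) ltac:(by rewrite divr_gt0).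
have ssc n : (N1 <= n)%N -> c0 / 2 <= ss n.
  by move=> /mmc; have := ms_ge n; lra.
apply: (@ratio_descent R _ _ (c0 / 2) (L1 h) 2) => //; last 1 first; first last.
- by exists N1 => n n1; split; [exact: DD_le|exact: ssc|exact: expect_le_L1].
- exact: ss_ge0.
- exact: DD_ge0.
- by rewrite divr_gt0.
move=> eps eps0; exists (4 * M * (1 + M)), (kp * eps * (c0 / 2) / M); split=> //.
- by rewrite !mulr_gt0 // ltr_wpDr // ltW.
- by rewrite !mulr_gt0 ?invr_gt0 // divr_gt0.
move=> T0 /win[T TT0 [N step]]; exists T => //.
have Tgt0 : 0 < T by case/andP: TT0.
(* This threshold depends on [T], which is legitimate because the first admissible window is chosen
   after [T]. *)
have [N2 mmT] := mm_small T Tgt0.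
exists (maxn N (maxn N1 N2)) => n; rewrite !geq_max => /and3P[Nn n1 n2].
have [m [l [A [nm [AM A2] [_ hs] hD wnd]]]] := step n Nn; exists m; split=> //.
  move=> j /wnd[_ h1 h2]; have MT : 0 < M * T by rewrite mulr_gt0.
  have : M * T <= 4 * M * (1 + M) * T.
    by rewrite ler_wpM2r ?ltW //; nra.
  by split; lra.
move=> epsD; have sc := ssc n n1; have D2 := DD_le n; have mT := mmT n n2.
have D0 := DD_ge0 n; have m0 := mm_ge0 n.
set D := DD n in hD epsD D2 D0 *; set s := ss n in hs sc epsD D2 *.
have s0 : 0 < s by lra.
have A0 : 0 <= A by apply: le_trans AM; rewrite divr_ge0 // ltW.
have e0 : 0 <= M * T ^+ 2 by rewrite mulr_ge0 ?sqr_ge0 // ltW.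
have hD' : DD m <= (l - A * kp) * D + 2 * (M * T ^+ 2).
  have : M * T * mm n <= M * T * T by rewrite ler_wpM2l // mulr_ge0 // ltW.
  by rewrite expr2; lra.
have hs' : l * s - M * T ^+ 2 <= ss m.
  have : 0 <= A * c * mm n by rewrite !mulr_ge0 // ltW.
  by lra.
have H1 : DD m * s - D * ss m <= (4 * (M * T ^+ 2) - A * kp * D) * s.
  have := ler_wpM2r (ltW s0) hD'; have := ler_wpM2l D0 hs'.
  have : D * (M * T ^+ 2) <= 2 * s * (M * T ^+ 2) by rewrite ler_wpM2r.
  by nra.
apply: le_trans H1 _; apply: ler_wpM2r; first exact: ltW.
apply: lerB.
  have : 0 <= M * (M * T ^+ 2) by rewrite mulr_ge0 // ltW.
  by nra.
have -> : kp * eps * (c0 / 2) / M * T = T / M * (kp * (eps * (c0 / 2))) by ring.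
rewrite -[A * kp * D]mulrA ler_pM //.
- by rewrite divr_ge0 // ltW.
- by rewrite !mulr_ge0 ?invr_ge0 //; lra.
- by rewrite ler_wpM2l ?(ltW kp_gt0) // (le_trans _ epsD) // ler_wpM2l // ltW.
Qed.

Theorem euler_windows_cvg y : (fun n => mu n y) @ \oo --> pi y.
Proof.
have c0_pos := c0_gt0.
have DD0 : DD @ \oo --> 0.
  apply/cvgr0Pnorm_le => e e0; have K0 : 0 < 1 + L1 h by rewrite ltr_wpDr // L1_ge0.
  have := DD_ratio_cvg0 => /cvgr0Pnorm_le /(_ (e / (1 + L1 h))).
  move=> /(_ ltac:(by rewrite divr_gt0)); apply: filterS => n.
  have D2 := DD_le n; have D0 := DD_ge0 n.
  rewrite !ger0_norm ?divr_ge0 ?DD_ge0 ?ss_ge0 //.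
  (* If ss n = 0 the quotient says nothing, but [DD_le] then forces DD n = 0. *)
  have [s0|] := ltP 0 (ss n); last by move=> s0 _; lra.
  rewrite ler_pdivrMr // => h1; apply: le_trans h1 _.
  rewrite mulrAC ler_pdivrMr // ler_wpM2l // ?(ltW e0) //.
  by have := expect_le_L1 n h; rewrite -/(ss n); lra.
(* As u + h >= c0, the l^1 norm of [phi] is at most (mm + DD) / c0; moreover 1 - ss is the total
   mass of [phi]. *)
have key n : `|mu n y - pi y| <= 2 / c0 * (mm n + DD n).
  have S : \sum_z `|phi n z| <= (mm n + DD n) / c0.
    rewrite ler_pdivlMr // -(sum_phi_u n) -big_split mulr_suml /=.
    by apply: ler_sum => z _; rewrite -mulrDr ler_wpM2l.
  have one_s : `|1 - ss n| <= \sum_z `|phi n z|.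
    have -> : 1 - ss n = \sum_z phi n z.
      rewrite sumrB -mulr_sumr; have [_ ->] := mu_prob n.
      by have [_ ->] := pi_prob; rewrite mulr1.
    exact: ler_norm_sum.
  have [pi0 pi1] := pi_prob.
  have piy : pi y <= 1.
    by rewrite -pi1 (bigD1 y) //= lerDl sumr_ge0.
  have -> : mu n y - pi y = phi n y - (1 - ss n) * pi y by rewrite /phi; ring.
  rewrite (le_trans (ler_normB _ _)) // normrM (ger0_norm (pi0 y)).
  have phiy : `|phi n y| <= \sum_z `|phi n z|.
    by rewrite (bigD1 y) //= lerDl sumr_ge0.
  have : `|1 - ss n| * pi y <= `|1 - ss n| * 1 by rewrite ler_wpM2l.
  by lra.
apply/cvgrPdist_le => e e0.
have /cvgr0Pnorm_le/(_ (e * c0 / 4)) /(_ ltac:(by rewrite divr_gt0 // mulr_gt0)) Hm := mm_cvg0.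
have /cvgr0Pnorm_le/(_ (e * c0 / 4)) /(_ ltac:(by rewrite divr_gt0 // mulr_gt0)) HD := DD0.
near=> n; rewrite distrC (le_trans (key n)) //.
have h1 : mm n <= e * c0 / 4.
  by rewrite -(ger0_norm (mm_ge0 n)); near: n.
have h2 : DD n <= e * c0 / 4.
  by rewrite -(ger0_norm (DD_ge0 n)); near: n.
rewrite mulrAC ler_pdivrMr //; lra.
Unshelve. all: by end_near. Qed.

End Attractor.

(** * Weighted occupation measures along a path *)

Section OccupationPath.
Variables (R : realType) (E : finType) (eta : nat -> R) (x : nat -> E).
Hypothesis eta_gt0 : forall n, 0 < eta n.

(** [occupation] along one fixed path: the reduction to the Euler scheme is pathwise. *)
Definition occ_path n (y : E) : R :=
  (\sum_(k < n.+1) eta k * (x k == y)%:R) / \sum_(k < n.+1) eta k.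

Lemma sum_eta_gt0 n : 0 < \sum_(k < n.+1) eta k.
Proof.
rewrite big_ord_recr /= ltr_wpDl //; apply: sumr_ge0 => k _; exact: ltW.
Qed.

Lemma gamma_gt0 n : 0 < gamma eta n.
Proof. by rewrite divr_gt0 // sum_eta_gt0. Qed.

Lemma gamma_le1 n : gamma eta n <= 1.
Proof.
rewrite ler_pdivrMr ?sum_eta_gt0 // mul1r big_ord_recr /= lerDr.
by apply: sumr_ge0 => k _; exact: ltW.
Qed.

Lemma occ_prob n : is_prob (occ_path n).
Proof.
have S0 := sum_eta_gt0 n; split=> [y|].
  apply: divr_ge0; last exact: ltW.
  by apply: sumr_ge0 => k _; rewrite mulr_ge0 // ltW.
rewrite -mulr_suml exchange_big /=; under eq_bigr do rewrite -mulr_sumr.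
rewrite (eq_bigr (fun k : 'I_n.+1 => eta k)); first by rewrite divff ?gt_eqF.
move=> k _; rewrite (bigD1 (x k)) //= eqxx big1 ?addr0 ?mulr1 // => y.
by rewrite eq_sym => /negbTE ->.
Qed.

Lemma occ_le1 n y : occ_path n y <= 1.
Proof.
have [ op0 <-] := occ_prob n; rewrite (bigD1 y) //= lerDl.
by apply: sumr_ge0 => z _; exact: op0.
Qed.

Lemma occ_step n y : occ_path n.+1 y =
  occ_path n y + gamma eta n.+1 * ((x n.+1 == y)%:R - occ_path n y).
Proof.
rewrite /occ_path /gamma !(big_ord_recr n.+1) /=.
have S0 := sum_eta_gt0 n; have S1 := sum_eta_gt0 n.+1.
rewrite big_ord_recr /= in S1.
by field; rewrite !gt_eqF.
Qed.

Lemma occ_window n m y : (n <= m)%N ->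
  `|occ_path m y - occ_path n y| <= \sum_(n <= j < m) gamma eta j.+1.
Proof.
elim: m => [|m IH]; first by rewrite leqn0 => /eqP ->; rewrite big_geq // subrr normr0.
rewrite leq_eqVlt => /orP[/eqP ->|nm]; first by rewrite big_geq // subrr normr0.
rewrite big_nat_recr //= occ_step.
have -> : forall g d, occ_path m y + g * d - occ_path n y =
  (occ_path m y - occ_path n y) + g * d by move=> g d; ring.
rewrite (le_trans (ler_normD _ _)) // lerD ?IH //.
rewrite normrM (gtr0_norm (gamma_gt0 _)) ler_piMr ?(ltW (gamma_gt0 _)) //.
have [ op0 _] := occ_prob m; have op1 := occ_le1 m y; have oy := op0 y.
by rewrite ler_norml; case: (_ == _) => /=; apply/andP; split; lra.
Qed.

Variables (K G : E -> E -> R).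
Hypotheses (K_sub : sub_Markovian K) (G_ge0 : forall z y, 0 <= G z y)
  (GE : forall z y, G z y = (z == y)%:R + \sum_w K z w * G w y)
  (gamma_dec : nonincreasing_seq (gamma eta)).

(** The martingale increment of [f] between times j and j + 1 under the reinforced kernel. *)
Definition noise (f : E -> R) j : R :=
  f (x j.+1) - \sum_z Kmu K (occ_path j) (x j) z * f z.

Definition killing (z : E) : R := 1 - mass K z [set: E]%SET.

Lemma killing_ge0 z : 0 <= killing z.
Proof. by have [_ /(_ z)[_]] := K_sub; rewrite /killing; lra. Qed.

Lemma killing_le1 z : killing z <= 1.
Proof. by have [_ /(_ z)[+ _]] := K_sub; rewrite /killing; lra. Qed.

Lemma sum_Kmu nu z (f : E -> R) :
  \sum_w Kmu K nu z w * f w = kfun K f z + killing z * expect nu f.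
Proof.
rewrite /expect mulr_sumr -big_split /=; apply: eq_bigr => w _.
by rewrite /Kmu -/(killing z); ring.
Qed.

(* Summation by parts: the increments of gamma have constant sign. *)
Lemma abel_window (b : nat -> R) F n m : (n < m)%N -> (forall j, 0 <= b j <= F) ->
  `|\sum_(n <= j < m) gamma eta j.+1 * (b j - b j.+1)| <= 2 * F * gamma eta n.+1.
Proof.
move=> nm bF; have F0 : 0 <= F by have := bF 0%N; lra.
have g0 j := gamma_gt0 j.
(* The boundary term gamma_m b_m closes the induction: lengthening the window changes the sum only
   by (gamma_m - gamma_{m+1}) b_m, up to sign. *)
suff : `|\sum_(n <= j < m) gamma eta j.+1 * (b j - b j.+1) + gamma eta m * b m|
   <= F * (2 * gamma eta n.+1 - gamma eta m).
  set s := \sum_(_ <= _ < _) _ => h.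
  have -> : s = (s + gamma eta m * b m) - gamma eta m * b m by ring.
  rewrite (le_trans (ler_normB _ _)) // normrM (gtr0_norm (g0 m)).
  have /andP[b0 b1] := bF m; rewrite (ger0_norm b0).
  have : gamma eta m * b m <= gamma eta m * F by rewrite ler_wpM2l // ltW.
  by lra.
elim: m nm => [//|m IH]; rewrite ltnS leq_eqVlt => /orP[/eqP <-|nm].
  have -> : \sum_(n <= j < n.+1) gamma eta j.+1 * (b j - b j.+1) + gamma eta n.+1 * b n.+1
     = gamma eta n.+1 * b n by rewrite big_nat1; ring.
  have /andP[b0 b1] := bF n; have gb : 0 <= gamma eta n.+1 * b n.
    by rewrite mulr_ge0 // ltW.
  rewrite (ger0_norm gb).
  have : gamma eta n.+1 * b n <= gamma eta n.+1 * F by rewrite ler_wpM2l // ltW.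
  by lra.
have := IH nm; rewrite big_nat_recr ?(ltnW nm) //=.
set s := \sum_(_ <= _ < _) _ => h.
have -> : s + gamma eta m.+1 * (b m - b m.+1) + gamma eta m.+1 * b m.+1 =
  (s + gamma eta m * b m) - (gamma eta m - gamma eta m.+1) * b m by ring.
rewrite (le_trans (ler_normB _ _)) // normrM.
have dec : 0 <= gamma eta m - gamma eta m.+1 by rewrite subr_ge0 gamma_dec.
have /andP[b0 b1] := bF m; rewrite (ger0_norm b0) (ger0_norm dec).
have : (gamma eta m - gamma eta m.+1) * b m <= (gamma eta m - gamma eta m.+1) * F.
  by rewrite ler_wpM2l.
by lra.
Qed.

(** The column f = G(., y) satisfies f - K f = 1_y, so the indicator of a visit to y is killing
    times mu(f), plus noise, plus a telescoping increment of f. Freezing the occupation measure at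
    time n costs O(t^2). *)
Lemma euler_step n m y (L : R) : (n < m)%N -> \sum_z G z y <= L ->
  forall t A, t = \sum_(n <= j < m) gamma eta j.+1 ->
  A = \sum_(n <= j < m) gamma eta j.+1 * killing (x j.+1) ->
  `|occ_path m y - ((1 - t) * occ_path n y + A * mkernel (occ_path n) G y)| <=
  (1 + L) * t ^+ 2 + 2 * L * gamma eta n.+1
  + `|\sum_(n <= j < m) gamma eta j.+1 * noise (fun z => G z y) j.+1|.
Proof.
move=> nm GL t A tE AE; set f := fun z => G z y.
have fL z : 0 <= f z <= L.
  rewrite G_ge0 /=; apply: le_trans GL; rewrite (bigD1 z) //= lerDl.
  by apply: sumr_ge0 => w _; exact: G_ge0.
have g0 j := gamma_gt0 j.
have t0 : 0 <= t by rewrite tE; apply: sumr_ge0 => j _; exact: ltW.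
have win j : (n <= j < m)%N -> \sum_(n <= i < j) gamma eta i.+1 <= t.
  move=> /andP[nj /ltnW jm]; rewrite tE (big_cat_nat nj jm) /= lerDl.
  by apply: sumr_ge0 => i _; exact: ltW.
have win' j : (n <= j < m)%N -> \sum_(n <= i < j.+1) gamma eta i.+1 <= t.
  move=> /andP[nj jm]; rewrite tE (@big_cat_nat _ _ _ j.+1 n m) ?(leqW nj) //= lerDl.
  by apply: sumr_ge0 => i _; exact: ltW.
have tele : occ_path m y - occ_path n y = \sum_(n <= j < m)
    gamma eta j.+1 * ((x j.+1 == y)%:R - occ_path j y).
  rewrite -(telescope_sumr (fun j => occ_path j y) (ltnW nm)).
  by apply: eq_bigr => j _; rewrite occ_step; ring.
have delta j : (x j.+1 == y)%:R = killing (x j.+1) * expect (occ_path j.+1) f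
     + noise f j.+1 + (f (x j.+1) - f (x j.+2)).
  rewrite /noise sum_Kmu; have := GE (x j.+1) y; rewrite -/(f _) -/(kfun K f _) => ->.
  by rewrite /kfun; ring.
pose P1 := \sum_(n <= j < m) gamma eta j.+1 * killing (x j.+1) *
  (expect (occ_path j.+1) f - expect (occ_path n) f).
pose P2 := \sum_(n <= j < m) gamma eta j.+1 * (occ_path j y - occ_path n y).
pose P3 := \sum_(n <= j < m) gamma eta j.+1 * (f (x j.+1) - f (x j.+2)).
pose P4 := \sum_(n <= j < m) gamma eta j.+1 * noise f j.+1.
have -> : occ_path m y - ((1 - t) * occ_path n y + A * mkernel (occ_path n) G y) =
    P1 - P2 + P3 + P4.
  have -> : mkernel (occ_path n) G y = expect (occ_path n) f by [].
  transitivity ((occ_path m y - occ_path n y) + t * occ_path n y - A * expect (occ_path n) f).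
    by ring.
  rewrite tele tE AE !mulr_suml /P1 /P2 /P3 /P4 -big_split -!sumrB /= -!big_split /=.
  by apply: eq_bigr => j _; rewrite delta; ring.
have Ltt : 0 <= L by have := fL (x 0%N); lra.
have hP1 : `|P1| <= L * t ^+ 2.
  rewrite (le_trans (ler_norm_sum _ _ _)) //.
  rewrite [leRHS](_ : _ = \sum_(n <= j < m) gamma eta j.+1 * (L * t)); last first.
    by rewrite -mulr_suml -tE; ring.
  rewrite !big_nat; apply: ler_sum => j jnm; rewrite -mulrA normrM (gtr0_norm (g0 _)).
  rewrite ler_wpM2l ?(ltW (g0 _)) // normrM (ger0_norm (killing_ge0 _)).
  have h1 : `|expect (occ_path j.+1) f - expect (occ_path n) f| <= L * t.
    rewrite expectBl (le_trans (@norm_expect_le _ _ _ f t _)) //.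
      move=> z; rewrite (le_trans (occ_window _ _)) ?win' //.
      by case/andP: jnm => /leqW.
    rewrite ler_wpM2r // (le_trans _ GL) // le_eqVlt; apply/orP; left; apply/eqP.
    by apply: eq_bigr => z _; rewrite ger0_norm // G_ge0.
  rewrite -[leRHS]mul1r ler_pM ?killing_ge0 ?killing_le1 //.
have hP2 : `|P2| <= t ^+ 2.
  rewrite (le_trans (ler_norm_sum _ _ _)) // expr2 {1}tE mulr_suml.
  rewrite !big_nat; apply: ler_sum => j jnm; rewrite normrM (gtr0_norm (g0 _)).
  rewrite ler_wpM2l ?(ltW (g0 _)) // (le_trans (occ_window _ _)) ?win //.
  by case/andP: jnm.
have hP3 : `|P3| <= 2 * L * gamma eta n.+1.
  by apply: (abel_window (b := fun j => f (x j.+1)) nm) => j; exact: fL.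
rewrite (le_trans (ler_normD _ _)) // -/P4 lerD2r.
rewrite (le_trans (ler_normD _ _)) // lerD //.
by rewrite (le_trans (ler_normB _ _)) //; lra.
Qed.

(** The overshoot beyond T is at most gamma_{n+1}, so the length is below 2 T once gamma is below
    T. *)
Definition is_window (T : R) n m := [/\ (n < m)%N,
  T <= \sum_(n <= j < m) gamma eta j.+1 &
  \sum_(n <= j < m) gamma eta j.+1 <= T + gamma eta n.+1].

Lemma euler_windows_occ : gamma eta @ \oo --> 0 ->
  (forall T0, 0 < T0 -> exists2 T, 0 < T <= T0 & exists win : nat -> nat,
    (forall n, is_window T n (win n)) /\
    forall y, (fun n => \sum_(n <= j < win n) gamma eta j.+1 *
        noise (fun z => G z y) j.+1) @ \oo --> 0) ->
  euler_windows G occ_path.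
Proof.
move=> gamma0 H; pose L := \sum_y \sum_z G z y.
have L0 : 0 <= L by apply: sumr_ge0 => y _; apply: sumr_ge0 => z _; exact: G_ge0.
have GL y : \sum_z G z y <= L.
  by rewrite /L [leRHS](bigD1 y) //= lerDl; apply: sumr_ge0 => ? _; apply: sumr_ge0.
(* The bound t <= 2 T contributes 4 (1 + L); summation by parts and the noise contribute one T^2
   each. *)
exists (4 * (1 + L) + 2); first by lra.
move=> T0 /H[T TT0 [win [isw noise0]]]; exists T => //.
have T_gt0 : 0 < T by case/andP: TT0.
have [N1 _ gT] : \forall n \near \oo, `|gamma eta n| <= Num.min T (T ^+ 2 / (2 * L + 1)).
  apply: (cvgr0_norm_le _ gamma0).
  by rewrite lt_min T_gt0 divr_gt0 ?exprn_gt0 //; lra.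
have [N2 _ nT] : \forall n \near \oo, forall y, `|\sum_(n <= j < win n) gamma eta j.+1 *
        noise (fun z => G z y) j.+1| <= T ^+ 2.
  apply: filter_forall => y; apply: (cvgr0_norm_le _ (noise0 y)).
  by rewrite exprn_gt0.
exists (maxn N1 N2) => n; rewrite geq_max => /andP[n1 n2].
have [nm Tt tT] := isw n; set m := win n in nm Tt tT.
have gn : gamma eta n.+1 <= Num.min T (T ^+ 2 / (2 * L + 1)).
  rewrite -(gtr0_norm (gamma_gt0 n.+1)); apply: gT; exact: leqW.
rewrite le_min in gn; case/andP: gn => g1 g2.
have t2 : \sum_(n <= j < m) gamma eta j.+1 <= 2 * T by lra.
have g0 j := gamma_gt0 j.
exists m, (\sum_(n <= j < m) gamma eta j.+1),
  (\sum_(n <= j < m) gamma eta j.+1 * killing (x j.+1)); split=> //.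
- split; first by apply: sumr_ge0 => j _; rewrite mulr_ge0 ?killing_ge0 // ltW.
  by apply: ler_sum => j _; rewrite ler_piMr ?killing_le1 // ltW.
- move=> y; apply: le_trans (euler_step nm (GL y) erefl erefl) _.
  have := nT n n2 y; rewrite -/m => h.
  have h2 : 2 * L * gamma eta n.+1 <= T ^+ 2.
    move: g2; rewrite ler_pdivlMr; last by lra.
    by have := g0 n.+1; nra.
  have h3 : (\sum_(n <= j < m) gamma eta j.+1) ^+ 2 <= 4 * T ^+ 2.
    have -> : 4 * T ^+ 2 = (2 * T) ^+ 2 by rewrite exprMn -natrX.
    by rewrite lerXn2r ?nnegrE //; lra.
  have : (1 + L) * (\sum_(n <= j < m) gamma eta j.+1) ^+ 2 <= (1 + L) * (4 * T ^+ 2).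
    by rewrite ler_wpM2l //; lra.
  by lra.
- move=> j /andP[nj jm] y; rewrite (le_trans (occ_window y nj)) //.
  apply: (@le_trans _ _ (2 * T)).
    apply: le_trans t2; rewrite [leRHS](big_cat_nat nj jm) /= lerDl.
    by apply: sumr_ge0 => i _; exact: ltW.
  by rewrite ler_wpM2r ?ltW //; lra.
Qed.

End OccupationPath.

(** * Exponential bounds for the noise *)

Section Window.
Variables (R : realType) (eta : nat -> R).
Hypotheses (eta_gt0 : forall n, 0 < eta n)
  (gamma_dec : nonincreasing_seq (gamma eta))
  (gamma_div : (\sum_(0 <= n <oo) (gamma eta n)%:E = +oo)%E).

Lemma window_exists T n : 0 < T -> exists m, is_window eta T n m.
Proof.
move=> T0; have g0 j := gamma_gt0 eta_gt0 j.
have [m hm] : exists m, T <= \sum_(n <= j < m) gamma eta j.+1.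
  (* Otherwise the partial sums of gamma would be bounded by the first n + 1 terms plus T. *)
  apply: contrapT => /forallNP H.
  have : (\sum_(0 <= k <oo) (gamma eta k)%:E <= (\sum_(k < n.+1) gamma eta k + T)%:E)%E.
    apply: lime_le; first by apply: is_cvg_nneseries => k _ _; rewrite lee_fin ltW.
    apply: nearW => N; rewrite sumEFin lee_fin.
    apply: (@le_trans _ _ (\sum_(0 <= k < maxn N n.+1) gamma eta k)).
      rewrite (@big_cat_nat _ _ _ N 0 (maxn N n.+1)) ?leq_maxl //= lerDl.
      by apply: sumr_ge0 => k _; rewrite ltW.
    rewrite (@big_cat_nat _ _ _ n.+1 0 (maxn N n.+1)) ?leq_maxr //= big_mkord lerD2l.
    case: (maxn N n.+1) (leq_maxr N n.+1) => // p _.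
    rewrite big_add1 /= ltW // ltNge; exact/negP.
  by rewrite gamma_div leye_eq.
pose P m := T <= \sum_(n <= j < m) gamma eta j.+1.
have exP : exists m, P m by exists m.
(* Minimality of m bounds the overshoot by the last term, itself at most gamma_{n+1}. *)
case: (ex_minnP exP) => {hm}m Pm mmin.
have nm : (n < m)%N.
  rewrite ltnNge; apply/negP => mn; move: Pm; rewrite /P big_geq //.
  by rewrite leNgt T0.
exists m; split => //.
case: m nm Pm mmin => // m; rewrite ltnS => nm Pm mmin.
rewrite big_nat_recr //= lerD //.
  by rewrite leNgt; apply/negP => /ltW /mmin; rewrite ltnn.
exact: gamma_dec.
Qed.

End Window.

(** * Exponential moments over finite histories *)

Section History.
Variables (R : realType) (E : finType) (K : E -> E -> R) (eta : nat -> R).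
Hypotheses (eta_gt0 : forall n, 0 < eta n) (K_sub : sub_Markovian K).

(** The head of a history of length k + 1 was visited at time k, so its weight is indexed by the
    length of the tail. *)
Fixpoint wsum (l : seq E) (y : E) : R :=
  if l is z :: l' then wsum l' y + eta (size l') * (z == y)%:R else 0.

(* Histories are listed backwards, the current state first. *)
Definition occ_hist (l : seq E) (y : E) : R := wsum l y / \sum_(k < size l) eta k.

Definition trans (l : seq E) (y : E) : R :=
  if l is z :: _ then Kmu K (occ_hist l) z y else 0.

Lemma sum_wsum l : \sum_y wsum l y = \sum_(k < size l) eta k.
Proof.
elim: l => [|a l IH] /=; first by rewrite big_ord0 big1.
rewrite big_split /= IH big_ord_recr /=; congr (_ + _).
rewrite -mulr_sumr (bigD1 a) //= eqxx big1 ?addr0 ?mulr1 // => y.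
by rewrite eq_sym => /negbTE ->.
Qed.

Lemma occ_hist_prob z l : is_prob (occ_hist (z :: l)).
Proof.
have S0 : 0 < \sum_(k < (size l).+1) eta k by exact: sum_eta_gt0.
have w0 l' y : 0 <= wsum l' y.
  by elim: l' => //= a l' IH; rewrite addr_ge0 // mulr_ge0 // ltW.
split=> [y|]; first by apply: divr_ge0 => //; exact: ltW.
by rewrite -mulr_suml sum_wsum divff // gt_eqF.
Qed.

Lemma trans_ge0 l y : 0 <= trans l y.
Proof.
case: l => [|z l] //=; have [ op0 _] := occ_hist_prob z l.
have [K0 /(_ z)[_ K1]] := K_sub.
by rewrite /Kmu addr_ge0 // mulr_ge0 // subr_ge0.
Qed.

Lemma trans_sum1 z l : \sum_y trans (z :: l) y = 1.
Proof.
have [_ op1] := occ_hist_prob z l.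
rewrite /= big_split /= -mulr_sumr op1 mulr1 /mass.
under [X in _ - X]eq_bigl do rewrite finset.in_setT.
by ring.
Qed.

(* Expectation of g (history k steps later), given the current history l. *)
Fixpoint Ex (k : nat) (g : seq E -> R) (l : seq E) : R :=
  if k is k'.+1 then \sum_y trans l y * Ex k' g (y :: l) else g l.

Lemma Ex_le k g1 g2 l : (forall l', g1 l' <= g2 l') -> Ex k g1 l <= Ex k g2 l.
Proof.
move=> g12; elim: k l => [|k IH] l //=; apply: ler_sum => y _.
by rewrite ler_wpM2l // trans_ge0.
Qed.

Lemma ExZ k g c l : Ex k (fun l' => c * g l') l = c * Ex k g l.
Proof.
elim: k l => [|k IH] l //=; rewrite mulr_sumr; apply: eq_bigr => y _.
by rewrite IH mulrCA.
Qed.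

Variable f : E -> R.

(** A martingale transform with deterministic weights. The oldest state has no past and its term is
    centred by 0; taking cf 0 = 0 discards it. *)
Fixpoint mart (cf : nat -> R) (l : seq E) : R :=
  if l is y :: l' then
    mart cf l' + cf (size l') * (f y - \sum_z trans l' z * f z)
  else 0.

(** From exp(-x) >= 1 - x one gets exp(x) (1 - x) <= 1, and (1 + x + 2 x^2)(1 - x) = 1 + (1 - 2 x)
    x^2 >= 1. *)
Lemma expR_le_quad (x : R) : x <= 2^-1 -> expR x <= 1 + x + 2 * x ^+ 2.
Proof.
move=> x2; have h := expR_ge1Dx (- x); have e0 := expR_gt0 x.
have : expR x * (1 - x) <= 1.
  by rewrite -[leRHS](expRxMexpNx_1 x) ler_wpM2l // ltW.
have : 0 <= (1 - 2 * x) * x ^+ 2 by rewrite mulr_ge0 ?sqr_ge0 //; lra.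
have : 0 < 1 - x by lra.
rewrite -(ler_pM2r (_ : 0 < 1 - x)); last by lra.
by rewrite !expr2; nra.
Qed.

(** Condition on the first step. The increments are centred, so the quadratic bound on the
    exponential leaves only a second-order term, which 1 + s <= exp(s) puts back into the
    exponent. *)
Lemma Ex_mart B cf k z l : (forall y, 0 <= f y <= B) ->
  (forall j, `|cf j| * B <= 2^-1) ->
  Ex k (fun l' => expR (mart cf l')) (z :: l) <=
  expR (mart cf (z :: l) + \sum_((size l).+1 <= j < (size l).+1 + k) 2 * (cf j * B) ^+ 2).
Proof.
move=> fB cB; have B0 : 0 <= B by have := fB z; lra.
elim: k z l => [|k IH] z l; first by rewrite addn0 big_geq // addr0.
set n := (size l).+1; set l1 := z :: l.
have mf : 0 <= \sum_z trans l1 z * f z <= B.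
  apply/andP; split.
    by apply: sumr_ge0 => y _; rewrite mulr_ge0 ?trans_ge0 //; have /andP[] := fB y.
  rewrite -[leRHS]mul1r -(trans_sum1 z l) mulr_suml; apply: ler_sum => y _.
  by rewrite ler_wpM2l ?trans_ge0 //; have /andP[] := fB y.
set mfv := \sum_z _ in mf.
have -> : \sum_(n <= j < n + k.+1) 2 * (cf j * B) ^+ 2 =
   2 * (cf n * B) ^+ 2 + \sum_(n.+1 <= j < n.+1 + k) 2 * (cf j * B) ^+ 2.
  by rewrite big_ltn ?addnS ?addSn // ltnS leq_addr.
set S := \sum_(n.+1 <= j < _) _.
apply: (@le_trans _ _ (\sum_y trans l1 y *
    expR (mart cf l1 + cf n * (f y - mfv) + S))).
  by apply: ler_sum => y _; rewrite ler_wpM2l ?trans_ge0 //; exact: IH.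
apply: (@le_trans _ _ (\sum_y trans l1 y *
    (expR (mart cf l1) * expR S * (1 + cf n * (f y - mfv) + 2 * (cf n * B) ^+ 2)))).
  apply: ler_sum => y _; rewrite ler_wpM2l ?trans_ge0 // !expRD mulrAC.
  rewrite ler_wpM2l ?mulr_ge0 ?expR_ge0 //.
  have ab : `|cf n * (f y - mfv)| <= `|cf n| * B.
    rewrite normrM ler_wpM2l // ler_norml; have := fB y.
    by move: mf => /andP[? ?] /andP[? ?]; apply/andP; split; lra.
  apply: le_trans (expR_le_quad _) _.
    by rewrite (le_trans (ler_norm _)) // (le_trans ab).
  rewrite lerD2l ler_wpM2l // -[leLHS]real_normK ?num_real // exprMn.
  rewrite -[cf n ^+ 2]real_normK ?num_real // -exprMn.
  by rewrite lerXn2r ?nnegrE // mulr_ge0.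
rewrite [leLHS](_ : _ = expR (mart cf l1) * expR S * (1 + 2 * (cf n * B) ^+ 2)).
  rewrite [leRHS](_ : _ = expR (mart cf l1) * expR S * expR (2 * (cf n * B) ^+ 2)).
    by rewrite ler_wpM2l ?mulr_ge0 ?expR_ge0 // expR_ge1Dx.
  by rewrite -!expRD; congr expR; ring.
(* The bracket multiplied by [cf n] vanishes, as [mfv] is the mean of [f] under [trans]. *)
transitivity (expR (mart cf l1) * expR S *
    ((1 + 2 * (cf n * B) ^+ 2) * \sum_y trans l1 y
     + cf n * (\sum_y trans l1 y * f y - mfv * \sum_y trans l1 y))).
  rewrite mulrBr !mulr_sumr -sumrB -big_split /= mulr_sumr.
  by apply: eq_bigr => y _; ring.
by rewrite trans_sum1 /mfv; ring.
Qed.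

Lemma martZ c cf l : mart (fun j => c * cf j) l = c * mart cf l.
Proof. by elim: l => [|y l /= ->]; [rewrite mulr0|ring]. Qed.

(** Chernoff's bound: the indicator is at most exp(lam (mart - e)). *)
Lemma Ex_mart_tail B cf k z (e lam : R) : (forall y, 0 <= f y <= B) ->
  (forall j, `|lam * cf j| * B <= 2^-1) -> 0 < lam -> cf 0%N = 0 ->
  Ex k (fun l => ((e <= mart cf l)%R)%:R) [:: z] <=
  expR (- (lam * e) + 2 * (lam * B) ^+ 2 * \sum_(1 <= j < k.+1) cf j ^+ 2).
Proof.
move=> fB cB lam0 cf0.
apply: (@le_trans _ _ (Ex k (fun l => expR (- (lam * e)) *
    expR (mart (fun j => lam * cf j) l)) [:: z])).
  apply: Ex_le => l; rewrite -expRD martZ.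
  case: (leP e (mart cf l)) => [h|_]; last exact: expR_ge0.
  by rewrite -[leLHS]expR0 ler_expR addrC subr_ge0 ler_pM2l.
rewrite ExZ expRD ler_wpM2l ?expR_ge0 //.
rewrite (le_trans (Ex_mart _ _ _ fB cB)) // ler_expR /= add1n.
rewrite cf0 mulr0 mul0r !add0r mulr_sumr.
rewrite le_eqVlt; apply/orP; left; apply/eqP.
by apply: eq_bigr => j _; ring.
Qed.

End History.

(** * The reinforced process *)

Section ReinforcedProcess.
Variables (R : realType) (E : finType) (K : E -> E -> R) (eta : nat -> R).
Variables (d : measure_display) (T : measurableType d) (P : probability T R).
Variables (x0 : E) (F : nat -> set (set T)) (X : nat -> T -> E).
Hypotheses (eta_gt0 : forall n, 0 < eta n) (K_sub : sub_Markovian K)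
  (rp : reinforced_process P K eta x0 F X).

Fixpoint hist (n : nat) (w : T) : seq E :=
  X n w :: if n is m.+1 then hist m w else [::].

Lemma size_hist n w : size (hist n w) = n.+1.
Proof. by elim: n => //= n ->. Qed.

Lemma occ_histE n w : occ_hist eta (hist n w) = occupation eta X n w.
Proof.
apply/funext => y; rewrite /occ_hist /occupation size_hist; congr (_ / _).
elim: n => [|n IH]; first by rewrite /= add0r big_ord_recl big_ord0 addr0.
by rewrite [LHS]/= IH size_hist [RHS]big_ord_recr.
Qed.

Lemma trans_hist n w y :
  trans K eta (hist n w) y = Kmu K (occupation eta X n w) (X n w) y.
Proof. by rewrite -occ_histE; case: n. Qed.

Lemma F_hist n l : F n (hist n @^-1` [set l]).
Proof.
have [[sF _ FS] XF _ _] := rp.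
have FI k A B : F k A -> F k B -> F k (A `&` B).
  have [F0 FC FU] := sF k; move=> FA FB.
  have -> : A `&` B = setT `\` \bigcup_i bigcup2 (setT `\` A) (setT `\` B) i.
    by rewrite bigcup2E !setTD setCU !setCK.
  by apply/FC/FU => -[|[|i]] /=; [exact: FC|exact: FC|].
have F00 k : F k set0 by have [] := sF k.
elim: n l => [|n IH] [|y l].
- by rewrite (_ : _ @^-1` _ = set0) //; apply/seteqP; split.
- case: l => [|z l].
    rewrite (_ : _ @^-1` _ = X 0%N @^-1` [set y]) //.
    by apply/seteqP; split => w /= [->].
  by rewrite (_ : _ @^-1` _ = set0) //; apply/seteqP; split => w //= [].
- by rewrite (_ : _ @^-1` _ = set0) //; apply/seteqP; split.
- rewrite (_ : _ @^-1` _ = X n.+1 @^-1` [set y] `&` hist n @^-1` [set l]).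
    by apply: FI; [exact: XF|apply/FS/IH].
  by apply/seteqP; split => w /= [-> ->].
Qed.

Lemma measurable_X n y : measurable (X n @^-1` [set y]).
Proof. by have [[_ Fm _] XF _ _] := rp; apply/Fm/XF. Qed.

Lemma measurable_hist_eq n l : measurable (hist n @^-1` [set l]).
Proof. by have [[_ Fm _] _ _ _] := rp; apply/Fm/F_hist. Qed.

Lemma bigcup_finType (A : E -> set T) :
  \bigcup_y A y = \big[setU/set0]_(y : E) A y.
Proof.
rewrite -bigcup_seq; congr bigcup; apply/seteqP; split=> y //= _.
by rewrite /= mem_index_enum.
Qed.

(** [E] is finite, so there are finitely many histories of each length and every set of them is an
    event. *)
Lemma measurable_hist n (B : set (seq E)) : measurable (hist n @^-1` B).
Proof.
elim: n B => [|n IH] B.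
  rewrite (_ : _ @^-1` _ = \bigcup_y (if `[<B [:: y]>] then X 0%N @^-1` [set y] else set0)).
    rewrite bigcup_finType; apply: bigsetU_measurable => y _.
    by case: ifP => // _; exact: measurable_X.
  apply/seteqP; split=> [w /= Bw|w [y _]].
    by exists (X 0%N w) => //; case: asboolP.
  by case: asboolP => //= By wy; rewrite /hist wy.
rewrite (_ : _ @^-1` _ =
    \bigcup_y (X n.+1 @^-1` [set y] `&` hist n @^-1` [set l | B (y :: l)])).
  rewrite bigcup_finType; apply: bigsetU_measurable => y _.
  by apply: measurableI; [exact: measurable_X|exact: IH].
apply/seteqP; split=> [w /= Bw|w [y _ [/= <- //]]].
by exists (X n.+1 w).
Qed.

Lemma measure_finType_le (A : E -> set T) : (forall y, measurable (A y)) ->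
  (P (\bigcup_y A y) <= \sum_(y : E) P (A y))%E.
Proof.
move=> mA; rewrite bigcup_finType.
have : measurable (\big[setU/set0]_(y : E) A y) by exact: bigsetU_measurable.
elim: (index_enum E) => [|y s IH]; first by rewrite !big_nil measure0.
rewrite !big_cons => _; have ms : measurable (\big[setU/set0]_(j <- s) A j).
  exact: bigsetU_measurable.
by rewrite (le_trans (measureU2 _ _ _)) // leeD2l // IH.
Qed.

(** On the event that the history is [l], the conditional probability of the next state is the
    constant [trans K eta l y]. *)
Lemma prob_step n l y : P (hist n @^-1` [set l] `&` X n.+1 @^-1` [set y]) =
  (P (hist n @^-1` [set l]) * (trans K eta l y)%:E)%E.
Proof.
have [_ _ _ cp] := rp; have [_ ->] := cp n y; last exact: F_hist.
rewrite muleC -integral_cst; last exact: measurable_hist_eq.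
by apply: eq_integral => w; rewrite inE /= => <-; rewrite trans_hist.
Qed.

(** Induction on [k]: split on the next state, bound the union by the sum, and absorb one transition
    through [prob_step]. *)
Lemma prob_future k n l (B : pred (seq E)) :
  (P (hist n @^-1` [set l] `&` [set w | B (hist (k + n) w)]) <=
   P (hist n @^-1` [set l]) * (Ex K eta k (fun l => (B l)%:R) l)%:E)%E.
Proof.
elim: k n l => [|k IH] n l.
  rewrite /= add0n; case: (boolP (B l)) => Bl /=.
    rewrite mule1; apply: le_measure; rewrite ?inE; last by move=> w [].
      by apply: measurableI; [|apply: (measurable_hist n [set l | B l])];
        exact: measurable_hist_eq.
    exact: measurable_hist_eq.
  rewrite (_ : _ `&` _ = set0) ?measure0 ?mule0 //.
  by apply/seteqP; split=> w //= [-> Bl']; rewrite Bl' in Bl.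
pose A y := hist n.+1 @^-1` [set y :: l] `&` [set w | B (hist (k + n.+1) w)].
have mA y : measurable (A y).
  apply: measurableI; first exact: measurable_hist_eq.
  exact: (measurable_hist (k + n.+1) [set l | B l]).
rewrite (_ : _ `&` _ = \bigcup_y A y); last first.
  apply/seteqP; split=> w /=.
    by move=> [/= lw Bw]; exists (X n.+1 w) => //; rewrite /A /= lw addnS.
  by move=> [y _ [/= [_ ->]]]; rewrite addnS.
apply: le_trans (measure_finType_le mA) _.
rewrite [Ex _ _ _ _ _]/= -sumEFin ge0_sume_distrr; last first.
  move=> y _; rewrite lee_fin mulr_ge0 ?trans_ge0 //.
  elim: (k) (y :: l) => [|k' IHk] l'; first by case: (B l').
  by apply: sumr_ge0 => z _; rewrite mulr_ge0 ?trans_ge0.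
apply: lee_sum => y _; apply: le_trans (IH _ _) _.
rewrite EFinM muleA -prob_step [X in (P X * _)%E](_ : _ =
  hist n @^-1` [set l] `&` X n.+1 @^-1` [set y]) //.
by apply/seteqP; split=> w /=; [move=> [-> ->]|move=> [-> ->]].
Qed.

Lemma prob_hist k (B : pred (seq E)) :
  (P [set w | B (hist k w)] <= (Ex K eta k (fun l => (B l)%:R) [:: x0])%:E)%E.
Proof.
have [_ _ X0 _] := rp.
have := prob_future k 0 [:: x0] B; rewrite addn0.
have -> : hist 0 @^-1` [set [:: x0]] = setT.
  by apply/seteqP; split=> w //= _; rewrite X0.
by rewrite setTI probability_setT mul1e.
Qed.

Lemma mart_hist f cf n w : cf 0%N = 0 -> mart K eta f cf (hist n w) =
  \sum_(0 <= j < n) cf j.+1 * noise eta (X^~ w) K f j.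
Proof.
move=> cf0; elim: n => [|n IH]; first by rewrite big_geq //= cf0 mul0r addr0.
rewrite [LHS]/= -/(hist n w) IH size_hist big_nat_recr //=; congr (_ + _ * _).
by rewrite /noise; congr (_ - _); apply: eq_bigr => z _; rewrite trans_hist.
Qed.

(** * Almost sure smallness of the window noise *)

Hypotheses (gamma_dec : nonincreasing_seq (gamma eta))
  (gamma_ln : gamma eta n * ln n%:R @[n --> \oo] --> (0 : R)).
Variables (S : R) (win : nat -> nat) (f : E -> R) (B : R).
Hypotheses (winP : forall n, is_window eta S n (win n)) (S_gt0 : 0 < S)
  (fB : forall y, 0 <= f y <= B).

Let wnoise w n := \sum_(n <= j < win n) gamma eta j.+1 * noise eta (X^~ w) K f j.+1.

(** Index shift: the noise of index j + 1 is revealed by the state at time j + 2, so its weight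
    gamma_{j+1} sits at position j + 2. *)
Let coef n j : R := if (n.+1 < j < (win n).+2)%N then gamma eta j.-1 else 0.

Lemma mart_wnoise n w : mart K eta f (coef n) (hist (win n).+1 w) = wnoise w n.
Proof.
have [nw _ _] := winP n.
rewrite mart_hist // (@big_cat_nat _ _ _ n.+1 0 (win n).+1) ?leqW //=.
rewrite big_nat big1 ?add0r; last first.
  by move=> j /andP[_ jn]; rewrite ltnS in jn; rewrite /coef ltnS ltnNge jn mul0r.
rewrite -(addn1 n) -(addn1 (win n)) big_addn addnK /wnoise.
rewrite !big_nat; apply: eq_bigr => j /andP[nj jw].
by rewrite !addn1 /coef !ltnS nj jw.
Qed.

Lemma sum_coef2 n : \sum_(1 <= j < (win n).+2) coef n j ^+ 2 <=
  gamma eta n.+1 * (S + 1).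
Proof.
have [nw _ tS] := winP n; have g0 j := gamma_gt0 eta_gt0 j.
have -> : \sum_(1 <= j < (win n).+2) coef n j ^+ 2 =
    \sum_(n <= j < win n) gamma eta j.+1 ^+ 2.
  transitivity (\sum_(n.+2 <= j < (win n).+2) coef n j ^+ 2).
    rewrite (@big_cat_nat _ _ _ n.+2 1 (win n).+2) ?ltnS ?(ltnW nw) //=.
    rewrite [X in X + _]big_nat big1 ?add0r // => j /andP[_].
    by rewrite ltnS leqNgt => /negbTE; rewrite /coef => ->; rewrite expr0n.
  rewrite -(addn2 n) -(addn2 (win n)) big_addn addnK !big_nat.
  apply: eq_bigr => j /andP[nj jw].
  by rewrite !addn2 /coef !ltnS nj jw.
apply: (@le_trans _ _ (gamma eta n.+1 * \sum_(n <= j < win n) gamma eta j.+1)).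
  rewrite mulr_sumr !big_nat; apply: ler_sum => j /andP[nj _].
  by rewrite expr2 ler_wpM2r ?(ltW (g0 _)) // gamma_dec.
rewrite ler_wpM2l ?(ltW (g0 _)) // (le_trans tS) // lerD2l.
exact: gamma_le1.
Qed.

Lemma coef_le n j : 0 <= coef n j <= gamma eta n.+1.
Proof.
have g0 i := ltW (gamma_gt0 eta_gt0 i); rewrite /coef; case: ifP => [|_].
  by case: j => // j /andP[nj _]; rewrite g0 gamma_dec.
by rewrite lexx g0.
Qed.

(** Chernoff's bound for [wnoise] and its opposite with lam = a / gamma_{n+1}. The squared weights
    sum to at most gamma_{n+1} (S + 1), so both terms of the exponent scale as 1 / gamma_{n+1}. *)
Lemma wnoise_tail e : 0 < e -> exists2 a, 0 < a & forall n,
  (P [set w | (e <= `|wnoise w n|)%R] <= (2 * expR (- (a / gamma eta n.+1)))%:E)%E.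
Proof.
move=> e0; have B0 : 0 <= B by have := fB x0; lra.
have S_pos := S_gt0.
(* The first bound keeps the scaled increments below 1/2; the second makes the variance term at most
   half of lam e. *)
pose a := Num.min (2 * (B + 1))^-1 (e / (4 * (B ^+ 2 + 1) * (S + 1))).
have B2 : 0 <= B ^+ 2 by exact: sqr_ge0.
have a0 : 0 < a.
  rewrite lt_min invr_gt0 divr_gt0 // ?mulr_gt0 //; lra.
have aB : a * B <= 2^-1.
  have : a <= (2 * (B + 1))^-1 by rewrite ge_min lexx.
  rewrite -[leRHS]mul1r ler_pdivlMr ?mulr_gt0 //; last by lra.
  by lra.
have ae : 2 * a * B ^+ 2 * (S + 1) <= e / 2.
  have : a <= e / (4 * (B ^+ 2 + 1) * (S + 1)) by rewrite ge_min lexx orbT.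
  rewrite ler_pdivlMr ?mulr_gt0 //; [|lra|lra].
  have : 0 <= a * (S + 1) by rewrite mulr_ge0 // ?ltW //; lra.
  by lra.
exists (a * e / 2); first by rewrite divr_gt0 // mulr_gt0.
move=> n; set g := gamma eta n.+1; have g0 : 0 < g by exact: gamma_gt0.
pose cfs (s : R) j := s * coef n j.
have mE s w : mart K eta f (cfs s) (hist (win n).+1 w) = s * wnoise w n.
  by rewrite -mart_wnoise -martZ.
have tail s : s = 1 \/ s = -1 ->
    (P [set w | (e <= s * wnoise w n)%R] <= (expR (- (a * e / 2 / g)))%:E)%E.
  move=> s1; have ns : `|s| = 1 by case: s1 => ->; rewrite ?normrN normr1.
  have s2 : s ^+ 2 = 1 by case: s1 => ->; rewrite ?sqrrN expr1n.
  have -> : [set w | (e <= s * wnoise w n)%R] =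
      [set w | (fun l => (e <= mart K eta f (cfs s) l)%R) (hist (win n).+1 w)].
    by apply/seteqP; split=> w; rewrite /mkset /preimage mE.
  apply: le_trans (prob_hist _ (fun l => (e <= mart K eta f (cfs s) l)%R)) _.
  rewrite lee_fin.
  have cB j : `|a / g * cfs s j| * B <= 2^-1.
    apply: le_trans aB; rewrite ler_wpM2r // !normrM ns mul1r (gtr0_norm a0).
    rewrite gtr0_norm ?invr_gt0 //; have /andP[c0 cg] := coef_le n j.
    by rewrite ger0_norm // -mulrA ler_piMr ?(ltW a0) // mulrC ler_pdivrMr ?mul1r.
  have lam0 : 0 < a / g by rewrite divr_gt0.
  have cf0 : cfs s 0%N = 0 by rewrite /cfs /coef mulr0.
  apply: le_trans (Ex_mart_tail eta_gt0 K_sub (win n).+1 x0 e fB cB lam0 cf0) _.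
  rewrite ler_expR; under eq_bigr do rewrite exprMn s2 mul1r.
  have := ler_wpM2l (_ : 0 <= 2 * (a / g * B) ^+ 2) (sum_coef2 n).
  move=> /(_ ltac:(by rewrite mulr_ge0 ?sqr_ge0)) h.
  apply: (@le_trans _ _ (- (a / g * e) + 2 * (a / g * B) ^+ 2 * (g * (S + 1)))).
    by rewrite lerD2l.
  have -> : 2 * (a / g * B) ^+ 2 * (g * (S + 1)) =
      a / g * (2 * a * B ^+ 2 * (S + 1)) by field; rewrite gt_eqF.
  have := ler_wpM2l (ltW lam0) ae; lra.
have -> : [set w | (e <= `|wnoise w n|)%R] =
    [set w | (e <= 1 * wnoise w n)%R] `|` [set w | (e <= -1 * wnoise w n)%R].
  apply/seteqP; split=> w /=; rewrite ler_normr mul1r mulN1r; first by move/orP.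
  by move=> H; apply/orP.
have mw s : measurable [set w | (e <= s * wnoise w n)%R].
  have -> : [set w | (e <= s * wnoise w n)%R] =
      [set w | (e <= mart K eta f (cfs s) (hist (win n).+1 w))%R].
    by apply/seteqP; split=> w; rewrite /mkset /preimage mE.
  exact: (measurable_hist _ [set l | (e <= mart K eta f (cfs s) l)%R]).
apply: le_trans (measureU2 _ _ _) _ => //.
rewrite mulr2n mulrDl mul1r EFinD leeD //; apply: tail; [left|right] => //.
Qed.

Lemma wnoise_cvg0 : {ae P, forall w, wnoise w @ \oo --> 0}.
Proof.
have evt e : 0 < e -> {ae P, forall w, \forall n \near \oo, `|wnoise w n| < e}.
  move=> e0; have [a a0 tail] := wnoise_tail e0.
  (* This makes exp(-a / gamma_{n+1}) at most (n + 1)^-2 for large n. *)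
  have [N _ gN] : \forall n \near \oo, `|gamma eta n * ln n%:R| <= a / 2.
    by apply: (cvgr0_norm_le _ gamma_ln); rewrite divr_gt0.
  (* Events before [N] are emptied so that the summable bound holds for every n. *)
  pose A n := if (n < N)%N then set0 else [set w | (e <= `|wnoise w n|)%R].
  have mA n : measurable (A n).
    rewrite /A; case: ifP => // _.
    have -> : [set w | (e <= `|wnoise w n|)%R] =
        [set w | (e <= `|mart K eta f (coef n) (hist (win n).+1 w)|)%R].
      by apply/seteqP; split=> w; rewrite /mkset /preimage mart_wnoise.
    exact: (measurable_hist _ [set l | (e <= `|mart K eta f (coef n) l|)%R]).
  (* Written as a telescoping difference, this majorant of 2 / (n + 1)^2 has partial sums at most
     4. *)
  have PA n : (P (A n) <= (4 * (n.+1%:R^-1 - n.+2%:R^-1))%:E)%E.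
    have n1 : 0 < n.+1%:R :> R by rewrite ltr0n.
    have n2 : 0 < n.+2%:R :> R by rewrite ltr0n.
    have n21 : n.+2%:R = n.+1%:R + 1 :> R by rewrite -natr1.
    have n11 : 1 <= n.+1%:R :> R by rewrite ler1n.
    have E1 : 4 * (n.+1%:R^-1 - n.+2%:R^-1) = 4 / (n.+1%:R * n.+2%:R) :> R.
      by rewrite n21; field; apply/andP; split; rewrite gt_eqF //; lra.
    rewrite /A; case: ifP => [_|/negbT]; first by rewrite measure0 E1 lee_fin divr_ge0 // mulr_ge0 ltW.
    rewrite -leqNgt => Nn; apply: le_trans (tail n) _; rewrite lee_fin E1.
    have g0 := gamma_gt0 eta_gt0 n.+1.
    have lnn : ln n.+1%:R * 2 <= a / gamma eta n.+1.
      have := gN n.+1 (leqW Nn) => /= /(le_trans (ler_norm _)) h.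
      by rewrite ler_pdivlMr //; lra.
    apply: (@le_trans _ _ (2 * expR (- (ln n.+1%:R * 2)))).
      by rewrite ler_wpM2l // ler_expR lerN2.
    have -> : expR (- (ln n.+1%:R * 2)) = (n.+1%:R ^+ 2)^-1 :> R.
      by rewrite expRN mulrC -[2]/(2%:R) expRM_natl lnK // posrE.
    rewrite ler_pdivlMr ?mulr_gt0 // mulrAC ler_pdivrMr ?exprn_gt0 // n21 expr2.
    by nra.
  have PL : P (lim_sup_set A) = 0%E.
    apply: lim_sup_set_cvg0 => //.
    apply: (@le_lt_trans _ _ 4%:E); last by rewrite ltry.
    apply: lime_le; first by apply: is_cvg_nneseries.
    apply: nearW => n; apply: (@le_trans _ _
        (\sum_(0 <= i < n) (4 * (i.+1%:R^-1 - i.+2%:R^-1))%:E)%E).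
      by apply: lee_sum => i _; exact: PA.
    rewrite sumEFin lee_fin -mulr_sumr.
    rewrite (_ : \sum_(0 <= i < n) _ = 1 - n.+1%:R^-1).
      by rewrite ler_piMr // gerBl invr_ge0.
    rewrite -(opprK (\sum_(0 <= i < n) _)) -sumrN.
    under eq_bigr do rewrite opprB.
    by rewrite (telescope_sumr (fun i => i.+1%:R^-1)) // invr1 opprB.
  exists (lim_sup_set A); split=> //.
    apply: bigcap_measurable => // i _; apply: bigcup_measurable => j _; exact: mA.
  move=> w /= H; apply: contrapT => nL; apply: H.
  have [n Hn] : exists n, ~ (\bigcup_(j >= n) A j) w.
    by apply: contrapT => /forallNP H; apply: nL => n _; apply: contrapT; exact: H.
  exists (maxn N n) => // j /=; rewrite geq_max => /andP[Nj nj].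
  rewrite ltNge; apply/negP => ej; apply: Hn; exists j => //.
  by rewrite /A ltnNge Nj.
(* Countably many tolerances 1 / (k + 1) give a single null set. *)
have : {ae P, forall w, forall k : nat,
    \forall n \near \oo, `|wnoise w n| < k.+1%:R^-1}.
  by apply: ae_foralln => k; apply: evt; rewrite invr_gt0.
apply: filterS => w H; apply/cvgr0Pnorm_lt => e e0.
have /ltr_add_invr[k] : 0 < e by [].
rewrite add0r => ke; apply: filterS (H k) => n; move/lt_trans; exact.
Qed.

End ReinforcedProcess.

(** * Integrals of non-increasing functions *)

Section IntegralTest.
Variables (R : realType) (C : R -> R).
Hypotheses (C_ge0 : forall s, 0 <= s -> 0 <= C s)
  (C_dec : forall s t, 0 <= s -> s <= t -> C t <= C s).
Notation leb := (@lebesgue_measure R).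

Lemma measurable_noninc : measurable_fun (`[(0:R), +oo[%classic : set R) C.
Proof.
(* Composing with max(0, s) gives a function monotone on the whole line and unchanged on [0,
   +oo[. *)
apply: (@eq_measurable_fun _ _ _ _ _ (fun s : R => C (Num.max 0 s))); last first.
  apply: nonincreasing_measurable => // s t st; apply: C_dec.
    by rewrite le_max lexx.
  by rewrite ge_max !le_max lexx /= st orbT.
by move=> s; rewrite inE /= in_itv /= andbT => s0; rewrite max_r.
Qed.


Lemma itv_nat_trivIset :
  trivIset setT (fun k : nat => `[(k%:R : R), k.+1%:R[%classic).
Proof.
apply/trivIsetP => i j _ _ ij; apply/seteqP; split=> // s [] /=.
rewrite !in_itv /= => /andP[i1 i2] /andP[j1 j2].
have := le_lt_trans i1 j2; have := le_lt_trans j1 i2.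
rewrite !ltr_nat !ltnS => h1 h2.
by move/eqP: ij; apply; apply/eqP; rewrite eqn_leq h1 h2.
Qed.

Lemma itv_nat_bigcup :
  \bigcup_(k : nat) `[(k%:R : R), k.+1%:R[%classic = `[0%R, +oo[%classic.
Proof.
apply/seteqP; split=> s /=.
  by move=> [k _] /=; rewrite !in_itv /= andbT => /andP[h _]; apply: le_trans h.
rewrite in_itv /= andbT => s0; exists (Num.truncn s) => //=.
by rewrite /= in_itv /=; exact: truncn_itv.
Qed.

Lemma integral_noninc : (\int[leb]_(s in `[0%R, +oo[) (C s)%:E =
  \sum_(0 <= k <oo) \int[leb]_(s in `[k%:R, k.+1%:R[) (C s)%:E)%E.
Proof.
rewrite -itv_nat_bigcup ge0_integral_bigcup //.
- by rewrite itv_nat_bigcup; apply/measurable_EFinP; exact: measurable_noninc.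
- by move=> s; rewrite itv_nat_bigcup /= in_itv /= andbT lee_fin; exact: C_ge0.
- exact: itv_nat_trivIset.
Qed.

Lemma itv_nat_sub k : `[(k%:R : R), k.+1%:R[%classic `<=` `[0%R, +oo[%classic.
Proof.
by move=> s /=; rewrite !in_itv /= andbT => /andP[h _]; apply: le_trans h.
Qed.

Lemma integral_cst_nat c k : (\int[leb]_(s in `[k%:R, k.+1%:R[) (cst c%:E s) = c%:E)%E.
Proof.
rewrite integral_cst //= lebesgue_measure_itv /= lte_fin ltr_nat ltnSn.
by rewrite -EFinD -natr1 addrAC subrr add0r mule1.
Qed.

Lemma measurable_noninc_nat k :
  measurable_fun (`[(k%:R : R), k.+1%:R[%classic : set R) C.
Proof.
apply: (measurable_funS _ (@itv_nat_sub k) measurable_noninc).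
exact: measurable_itv.
Qed.

Lemma integral_noninc_le : (\int[leb]_(s in `[0%R, +oo[) (C s)%:E <=
  \sum_(0 <= k <oo) (C k%:R)%:E)%E.
Proof.
rewrite integral_noninc; apply: lee_nneseries => [k _ _|k _].
  apply: integral_ge0 => s /itv_nat_sub /=.
  by rewrite in_itv /= andbT lee_fin => /C_ge0.
rewrite -[leRHS](integral_cst_nat _ k).
apply: ge0_le_integral => //=.
- by move=> s /itv_nat_sub /=; rewrite in_itv /= andbT lee_fin => /C_ge0.
- by apply/measurable_EFinP; exact: measurable_noninc_nat.
- by move=> s; rewrite in_itv /= => /andP[h _]; rewrite lee_fin C_dec.
Qed.

Lemma integral_noninc_ge : (\sum_(0 <= k <oo) (C k.+1%:R)%:E <=
  \int[leb]_(s in `[0%R, +oo[) (C s)%:E)%E.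
Proof.
rewrite integral_noninc; apply: lee_nneseries => [k _ _|k _].
  by rewrite lee_fin C_ge0.
rewrite -[leLHS](integral_cst_nat _ k).
apply: ge0_le_integral => //=.
- by move=> s _; rewrite lee_fin C_ge0.
- by apply/measurable_EFinP; exact: measurable_noninc_nat.
- move=> s; rewrite in_itv /= => /andP[h1 h2]; rewrite lee_fin C_dec ?(ltW h2) //.
  exact: le_trans h1.
Qed.

End IntegralTest.

(** The integral dominates the series of c / (k + 2), which diverges with the harmonic series. *)
Lemma integral_hyperbola (R : realType) (c : R) : 0 < c ->
  (\int[@lebesgue_measure R]_(s in `[0%R, +oo[) (c / (1 + s))%:E = +oo)%E.
Proof.
move=> c0; apply/eqP; rewrite -leye_eq.
apply: le_trans (integral_noninc_ge (C := fun s => c / (1 + s)) _ _); last 2 first.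
- by move=> s s0; rewrite divr_ge0 ?addr_ge0 // ltW.
- move=> s t s0 st; rewrite ler_pM2l // lef_pV2 ?posrE ?lerD2l //.
    by rewrite ltr_pwDl // (le_trans s0).
  by rewrite ltr_pwDl.
rewrite leye_eq; apply/eqP; apply: contrapT => fin.
have u0 (k : nat) : 0 <= c / (1 + k.+1%:R) by rewrite divr_ge0 ?addr_ge0 // ltW.
have cvu : cvgn (series (fun k : nat => c / (1 + k.+1%:R))).
  by apply: nnseries_is_cvg => //; rewrite ltey; apply/eqP.
apply: (@dvg_harmonic R).
apply: (series_le_cvg (v_ := fun k : nat => 2 / c * (c / (1 + k.+1%:R)))) => [k|k|k|].
- by rewrite /harmonic /= invr_ge0.
- by rewrite mulr_ge0 ?divr_ge0 // ltW.
- rewrite /harmonic /= (_ : 2 / c * _ = 2 / (1 + k.+1%:R)); last first.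
    by field; rewrite !gt_eqF // ltr_pwDl.
  by rewrite ler_pdivlMr ?ltr_pwDl // mulrC ler_pdivrMr // -natr1; have := ler0n R k; lra.
- exact: is_cvg_seriesZ.
Qed.

(** * Kernels with two communicating classes *)

Section Restriction.
Variables (R : realType) (E : finType) (K : E -> E -> R) (A : {set E}).
Hypothesis K_ge0 : forall x y, 0 <= K x y.
Implicit Types f : {z : E | z \in A} -> R.

Lemma extend_val f z : extend f (val z) = f z.
Proof. by rewrite /extend valK. Qed.

Lemma extend_out f x : x \notin A -> extend f x = 0.
Proof. by move=> xA; rewrite /extend insubN. Qed.

Lemma extend_in f (P : E -> R -> Prop) :
  (forall z, P (val z) (f z)) -> forall x, x \in A -> P x (extend f x).
Proof. by move=> H x xA; rewrite -[x]/(val (Sub x xA : {z | z \in A})) extend_val. Qed.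

Lemma sum_extend (F : E -> R) f :
  \sum_x F x * extend f x = \sum_z F (val z) * f z.
Proof.
rewrite (bigID (mem A)) /= [X in _ + X]big1 ?addr0; last first.
  by move=> x xA; rewrite extend_out // mulr0.
by rewrite big_sub; apply: eq_bigr => z _; rewrite extend_val.
Qed.

Lemma expect_extend (g : E -> R) f :
  expect (extend f) g = expect f (fun z => g (val z)).
Proof.
rewrite /expect; under eq_bigr do rewrite mulrC.
by rewrite sum_extend; apply: eq_bigr => z _; rewrite mulrC.
Qed.

Lemma extend_prob f : is_prob f -> is_prob (extend f).
Proof.
move=> [f0 f1]; split=> [x|].
  case: (boolP (x \in A)) => [|xA]; last by rewrite extend_out.
  exact: (extend_in (P := fun _ r => 0 <= r)).
rewrite -f1; have := sum_extend (fun=> 1) f.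
by under eq_bigr do rewrite mul1r; move=> ->; apply: eq_bigr => z _; rewrite mul1r.
Qed.

(** The hypothesis says that no path leaves [A] and comes back. Stated as a vanishing product it
    fits both classes: nothing returns to [E1], and nothing leaves [E2]. *)
Lemma restr_kpow n (x y : {z : E | z \in A}) :
  (forall n x y z, x \in A -> y \in A -> z \notin A -> K x z * kpow K n z y = 0) ->
  kpow (restr K A) n x y = kpow K n (val x) (val y).
Proof.
move=> noexit; elim: n x => [|n IH] x //=.
rewrite [RHS](bigID (mem A)) /= [X in _ + X]big1 ?addr0; last first.
  by move=> z zA; apply: noexit => //; exact: valP.
by rewrite [RHS]big_sub; apply: eq_bigr => z _; rewrite IH.
Qed.

Lemma restr_irreducible :
  (forall n x y z, x \in A -> y \in A -> z \notin A -> K x z * kpow K n z y = 0) ->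
  (forall x y, x \in A -> y \in A -> leads K x y) ->
  irreducible_kernel (restr K A).
Proof.
move=> noexit irr x y.
have /(leadsP K_ge0)[n hn] := irr _ _ (valP x) (valP y).
by exists n; rewrite restr_kpow.
Qed.

End Restriction.

Lemma qsd_eigen (R : realType) (I : finType) (Q : I -> I -> R) mu :
  is_qsd Q mu -> extinction_rate Q mu != 0 /\
  forall y, mkernel mu Q y = extinction_rate Q mu * mu y.
Proof.
(* With a zero extinction rate every quotient is 0 by the convention on inverses, against total mass
   1. *)
move=> [[mu0 mu1] muE]; have r0 : extinction_rate Q mu != 0.
  apply/eqP => r0; have := oner_neq0 R; rewrite -mu1 big1 ?eqxx // => y _.
  by rewrite muE r0 invr0 mulr0.
by split=> // y; rewrite [in RHS]muE mulrC divfK.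
Qed.

(** A quasi-stationary distribution is a non-negative left eigenvector, positive by irreducibility
    of the transpose; its eigenvalue is then the spectral radius. *)
Lemma qsd_spectral (R : realType) (I : finType) (Q : I -> I -> R) mu :
  (forall x y, 0 <= Q x y) -> irreducible_kernel Q -> is_qsd Q mu ->
  [/\ 0 < extinction_rate Q mu, forall x, 0 < mu x
    & extinction_rate Q mu = spectral_radius Q].
Proof.
move=> Q0 irr qsd; have [r0 muE] := qsd_eigen qsd.
have [[mu0 mu1] _] := qsd; set r := extinction_rate Q mu in r0 muE *.
have rge0 : 0 <= r.
  by apply: sumr_ge0 => x _; rewrite mulr_ge0 // kfun_ge0 // => y; rewrite /one.
have [x0 mux0] : exists x, 0 < mu x.
  apply: contrapT => /forallNP H; have := mu1; rewrite big1 => [|x _].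
    by move/eqP; rewrite eq_sym oner_eq0.
  by apply: le_anti; rewrite mu0 leNgt; have /negP -> := H x.
have mu_gt0 : forall x, 0 < mu x.
  apply: (positive_eigenvector (Q := ktr Q) (r := r)) => //.
  - by move=> x y; exact: Q0.
  - exact: irreducible_ktr.
  - by exists x0.
  - by move=> x; rewrite kfun_ktr.
split=> //; first by rewrite lt_neqAle eq_sym r0.
by rewrite (spectral_radiusE x0 Q0 rge0 mu_gt0 muE).
Qed.

(** * The two classes, their quasi-stationary distributions and Perron vectors *)

Section Reducible.
Variables (R : realType) (E : finType) (E1 E2 : {set E}) (K : E -> E -> R).
Variable mu2 : {z : E | z \in E2} -> R.
Hypotheses (E12 : E1 :|: E2 = [set: E]%SET) (disjE12 : E1 :&: E2 = finset.set0)
  (E1_neq0 : E1 != finset.set0) (E2_neq0 : E2 != finset.set0)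
  (subK : sub_Markovian K)
  (irr1 : forall x y, x \in E1 -> y \in E1 -> leads K x y)
  (irr2 : forall x y, x \in E2 -> y \in E2 -> leads K x y)
  (lead12 : leads_set K E1 E2) (nlead21 : ~ leads_set K E2 E1)
  (killed2 : exists2 x, x \in E2 & mass K x [set: E]%SET < 1)
  (mu2_qsd : is_qsd (restr K E2) mu2).

Let r1 := spectral_radius (restr K E1).
Let r2 := spectral_radius (restr K E2).
Let pi := extend mu2.

Lemma K_ge0 x y : 0 <= K x y. Proof. by have [+ _] := subK; apply. Qed.

Lemma notin_E1 x : (x \notin E1) = (x \in E2).
Proof.
have /setP/(_ x) := E12; have /setP/(_ x) := disjE12.
by rewrite !inE; case: (x \in E1); case: (x \in E2).
Qed.

Lemma notin_E2 x : (x \notin E2) = (x \in E1).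
Proof. by rewrite -notin_E1 negbK. Qed.

Lemma kpow21 n x y : x \in E2 -> y \in E1 -> kpow K n x y = 0.
Proof.
move=> x2 y1; apply: contrapT => /eqP h; apply: nlead21; exists x, y; split=> //.
apply/(leadsP K_ge0); exists n; rewrite lt_neqAle eq_sym h.
exact: (kpow_ge0 K_ge0).
Qed.

Lemma K21 x y : x \in E2 -> y \in E1 -> K x y = 0.
Proof. by move=> x2 y1; rewrite -kpow1 kpow21. Qed.

Lemma noexit1 n x y z : x \in E1 -> y \in E1 -> z \notin E1 ->
  K x z * kpow K n z y = 0.
Proof. by rewrite notin_E1 => _ y1 z2; rewrite kpow21 // mulr0. Qed.

Lemma noexit2 n x y z : x \in E2 -> y \in E2 -> z \notin E2 ->
  K x z * kpow K n z y = 0.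
Proof. by rewrite notin_E2 => x2 _ z1; rewrite K21 // mul0r. Qed.

Lemma irreducible1 : irreducible_kernel (restr K E1).
Proof. exact: (restr_irreducible K_ge0 noexit1). Qed.

Lemma irreducible2 : irreducible_kernel (restr K E2).
Proof. exact: (restr_irreducible K_ge0 noexit2). Qed.

Lemma leads12 x y : x \in E1 -> y \in E2 -> leads K x y.
Proof.
move=> x1 y2; have [a [b [a1 b2 ab]]] := lead12.
apply: (leads_trans K_ge0 (irr1 x1 a1)); apply: (leads_trans K_ge0 ab).
exact: irr2.
Qed.

Lemma qsd1 mu1 : is_qsd (restr K E1) mu1 -> extinction_rate (restr K E1) mu1 = r1.
Proof.
by move=> q1; have [] := qsd_spectral (fun x y => K_ge0 _ _) irreducible1 q1.
Qed.

Lemma qsd2 : [/\ 0 < r2, forall z, 0 < mu2 z & extinction_rate (restr K E2) mu2 = r2].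
Proof.
have [a b c] := qsd_spectral (fun x y => K_ge0 _ _) irreducible2 mu2_qsd.
by rewrite /r2 -c.
Qed.

Lemma r2_gt0 : 0 < r2. Proof. by have [] := qsd2. Qed.

Lemma pi_prob : is_prob pi.
Proof. by apply: extend_prob; have [] := mu2_qsd. Qed.

Lemma pi_gt0 x : x \in E2 -> 0 < pi x.
Proof. by apply: (extend_in (P := fun _ r => 0 < r)); have [] := qsd2. Qed.

Lemma pi_out x : x \in E1 -> pi x = 0.
Proof. by move=> x1; rewrite /pi extend_out // notin_E2. Qed.

(** Nothing flows from [E2] to [E1], so the eigenvector equation of the restriction extends by 0 to
    all of [E]. *)
Lemma piK y : mkernel pi K y = r2 * pi y.
Proof.
have -> : mkernel pi K y = \sum_x K x y * pi x by apply: eq_bigr => x _; rewrite mulrC.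
rewrite sum_extend; case: (boolP (y \in E2)) => y2; last first.
  rewrite notin_E2 in y2; rewrite pi_out // mulr0 big1 // => z _.
  by rewrite K21 ?mul0r //; exact: valP.
have [_ _ rE] := qsd2; have [_ muE] := qsd_eigen mu2_qsd.
have := muE (Sub y y2); rewrite rE -[mu2 (Sub _ _)]extend_val -/pi => <-.
by apply: eq_bigr => z _; rewrite mulrC.
Qed.

Lemma kfun_one x : kfun K (@Defs.one R E) x = mass K x [set: E]%SET.
Proof.
rewrite /kfun /mass; under [RHS]eq_bigl do rewrite finset.in_setT.
by apply: eq_bigr => y _; rewrite mulr1.
Qed.

Lemma expect_pi_one : expect pi (kfun K (@Defs.one R E)) = r2.
Proof.
rewrite expect_kfun (_ : mkernel pi K = fun y => r2 * pi y); last by apply/funext/piK.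
rewrite expectZl; have [_ p1] := pi_prob.
by rewrite -[RHS]mulr1 -p1; congr (_ * _); apply: eq_bigr => y _; rewrite mulr1.
Qed.

(** [pi] charges the state of [E2] where mass is lost, so pi(K 1) < 1. *)
Lemma r2_lt1 : r2 < 1.
Proof.
have [x x2 xk] := killed2; have [p0 p1] := pi_prob.
rewrite -expect_pi_one -p1 /expect [ltLHS](bigD1 x) //= [ltRHS](bigD1 x) //=.
apply: ltr_leD; first by rewrite kfun_one gtr_pMr ?pi_gt0.
apply: ler_sum => y _; rewrite kfun_one ler_piMr //.
by have [_ /(_ y)[]] := subK.
Qed.

Lemma pi_qsd : is_qsd K pi.
Proof.
split=> [|y]; first exact: pi_prob.
by rewrite /extinction_rate expect_pi_one piK mulrAC divff ?mul1r // gt_eqF ?r2_gt0.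
Qed.

(* Perron eigenvectors of K_1 and K_2, extended by 0. *)
Lemma eigenfunctions : exists u h : E -> R,
  [/\ [/\ forall x, x \in E1 -> 0 < u x, forall x, x \in E2 -> u x = 0
        & forall x, kfun K u x = r1 * u x],
      [/\ forall x, x \in E2 -> 0 < h x, forall x, x \in E1 -> h x = 0,
          forall x, x \in E2 -> kfun K h x = r2 * h x & expect pi h = 1]
    & 0 <= r1].
Proof.
have [a a1] := set0Pn _ E1_neq0; have [b b2] := set0Pn _ E2_neq0.
have [s1 [u1 [v1 [s10 u10 _ [u1E _ s1E]]]]] :=
  perron_frobenius (Sub a a1) (fun x y => K_ge0 _ _) irreducible1.
have [s2 [h2 [v2 [s20 h20 _ [h2E _ s2E]]]]] :=
  perron_frobenius (Sub b b2) (fun x y => K_ge0 _ _) irreducible2.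
have N0 : 0 < expect mu2 h2.
  have [_ mu20 _] := qsd2; rewrite /expect (bigD1 (Sub b b2)) //= ltr_wpDr ?mulr_gt0 //.
  by apply: sumr_ge0 => z _; rewrite mulr_ge0 // ltW.
(* Normalized so that pi(h) = 1. *)
pose h x := (expect mu2 h2)^-1 * extend h2 x.
exists (extend u1), h; split; last by rewrite /r1 s1E.
- split=> [x|x|x]; first exact: (extend_in (P := fun _ r => 0 < r)).
    by rewrite -notin_E1; exact: extend_out.
  rewrite /kfun sum_extend; case: (boolP (x \in E1)) => [x1|].
    by have := u1E (Sub x x1); rewrite /r1 s1E -[u1 (Sub _ _)]extend_val.
  rewrite notin_E1 => x2; rewrite extend_out ?notin_E1 // mulr0 big1 // => z _.
  by rewrite K21 ?mul0r //; exact: valP.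
- split=> [x x2|x|x x2|].
  + by rewrite mulr_gt0 ?invr_gt0 //; exact: (extend_in (P := fun _ r => 0 < r)).
  + by rewrite -notin_E2 => x2; rewrite /h extend_out // mulr0.
  + rewrite kfunZ mulrCA; congr (_ * _); rewrite /kfun sum_extend.
    by have := h2E (Sub x x2); rewrite /r2 s2E -[h2 (Sub _ _)]extend_val.
  + rewrite expectZ expect_extend.
    have -> : (fun z : {z | z \in E2} => extend h2 (val z)) = h2.
      by apply/funext => z; rewrite extend_val.
    by rewrite mulVf // gt_eqF.
Qed.

(** * Estimates on the Green kernel of K *)

Section Eigen.
Variables (u h : E -> R).
Hypotheses (u_gt0 : forall x, x \in E1 -> 0 < u x) (u_out : forall x, x \in E2 -> u x = 0)
  (Ku : forall x, kfun K u x = r1 * u x)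
  (h_gt0 : forall x, x \in E2 -> 0 < h x) (h_out : forall x, x \in E1 -> h x = 0)
  (Kh : forall x, x \in E2 -> kfun K h x = r2 * h x) (pih : expect pi h = 1)
  (r1_ge0 : 0 <= r1).

Lemma u_ge0 x : 0 <= u x.
Proof.
by case: (boolP (x \in E1)) => [/u_gt0/ltW//|]; rewrite notin_E1 => /u_out ->.
Qed.

Lemma h_ge0 x : 0 <= h x.
Proof.
by case: (boolP (x \in E2)) => [/h_gt0/ltW//|]; rewrite notin_E2 => /h_out ->.
Qed.

Lemma uh_lower : exists2 c, 0 < c & forall x, c <= u x + h x.
Proof.
apply: fin_min_gt0 => x; case: (boolP (x \in E1)) => [x1|].
  by rewrite ltr_pwDl ?u_gt0 ?h_ge0.
by rewrite notin_E1 => x2; rewrite ltr_wpDl ?h_gt0 ?u_ge0.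
Qed.

Lemma Kh_lower x : r2 * h x <= kfun K h x.
Proof.
case: (boolP (x \in E2)) => [/Kh -> //|]; rewrite notin_E2 => /h_out ->.
by rewrite mulr0; apply: kfun_ge0 => //; [exact: K_ge0|exact: h_ge0].
Qed.

Lemma Kh_upper : exists2 C, 0 < C & forall x, kfun K h x <= r2 * h x + C * u x.
Proof.
have [C C0 HC] := fin_max_ub (fun x => kfun K h x / u x).
exists C => // x; case: (boolP (x \in E1)) => [x1|].
  by rewrite h_out // mulr0 add0r -ler_pdivrMr ?u_gt0.
by rewrite notin_E1 => x2; rewrite Kh // u_out // mulr0 addr0.
Qed.

Hypothesis r12 : r1 <= r2.

Let th := (1 - r2)^-1.

Lemma th_gt0 : 0 < th. Proof. by rewrite invr_gt0 subr_gt0 r2_lt1. Qed.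

Lemma attractor_facts : exists (G : E -> E -> R) (c C kp c0 : R),
  [/\ [/\ forall x y, 0 <= G x y,
         forall x y, G x y = (x == y)%:R + \sum_z K x z * G z y
       & forall x y, G x y = (x == y)%:R + \sum_z G x z * K z y],
      [/\ 0 < c, 0 <= C, 0 < kp, 0 < c0 & forall x, c0 <= u x + h x],
      forall x, kfun G u x <= th * u x,
      forall x, th * h x + c * u x <= kfun G h x /\ kfun G h x <= th * h x + C * u x
    & (forall y, mkernel pi G y = th * pi y) /\
      (forall x y, kp * h x * pi y <= G x y)].
Proof.
have r2lt := r2_lt1; have r2gt := r2_gt0; have r12' := r12; have r1ge := r1_ge0.
have th0 := th_gt0; have r20 : 1 - r2 != 0 by rewrite gt_eqF // subr_gt0.
have [c0 c00 uh] := uh_lower; have [C C0 HC] := Kh_upper.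
(* The weight of [u] in [w], multiplied by rho - r2, equals [C]: it absorbs the excess of K h over
   r2 h on [E1]. *)
pose rho := (1 + r2) / 2; pose w x := h x + (2 * C / (1 - r2)) * u x.
have q0 : 0 < 2 * C / (1 - r2) by rewrite divr_gt0 ?mulr_gt0 // subr_gt0.
have w0 x : 0 < w x.
  rewrite /w; case: (boolP (x \in E1)) => [x1|].
    by rewrite ltr_wpDl ?h_ge0 // mulr_gt0 // u_gt0.
  by rewrite notin_E1 => x2; rewrite ltr_pwDl ?h_gt0 // mulr_ge0 ?u_ge0 // ltW.
have rho1 : rho < 1 by rewrite /rho; lra.
have Kw x : kfun K w x <= rho * w x.
  rewrite kfunD kfunZ Ku; apply: le_trans (lerD (HC x) (lexx _)) _.
  have ux := u_ge0 x; have hx := h_ge0 x.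
  have -> : rho * w x = rho * h x + (rho - r2) * (2 * C / (1 - r2)) * u x
      + r2 * (2 * C / (1 - r2)) * u x by rewrite /w; ring.
  have -> : (rho - r2) * (2 * C / (1 - r2)) = C by rewrite /rho; field.
  have : r1 * (2 * C / (1 - r2) * u x) <= r2 * (2 * C / (1 - r2) * u x).
    by rewrite ler_wpM2r // mulr_ge0 // ltW.
  have : r2 * h x <= rho * h x by rewrite ler_wpM2r // /rho; lra.
  by lra.
have [G [G0 GE GE' Gk]] := green_exists K_ge0 w0 rho1 Kw.
have G_pos x y : leads K x y -> 0 < G x y.
  by move=> /(leadsP K_ge0)[n hn]; apply: lt_le_trans (Gk n x y).
have G_ge0' f x : (forall y, 0 <= f y) -> 0 <= kfun G f x by exact: kfun_ge0.
have Gu x : kfun G u x <= th * u x.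
  have := kfun_green u x GE'; rewrite (_ : kfun K u = fun x => r1 * u x); last exact/funext.
  rewrite kfunZ => H; rewrite -[leRHS]mulrC ler_pdivlMr ?subr_gt0 //.
  have := G_ge0' u x u_ge0; nra.
(* [b] is the part of K h due to the passage from [E1] to [E2]; it satisfies (1 - r2) G h = h + G
   b. *)
pose b x := kfun K h x - r2 * h x.
have b0 x : 0 <= b x by rewrite subr_ge0 Kh_lower.
have bC x : b x <= C * u x by rewrite lerBlDl HC.
have Gh x : kfun G h x = th * (h x + kfun G b x).
  have := kfun_green h x GE'.
  rewrite (_ : kfun K h = fun x => r2 * h x + b x); last by apply/funext => y; rewrite /b; ring.
  rewrite kfunD kfunZ => H; have : (1 - r2) * kfun G h x = h x + kfun G b x by lra.
  by move=> <-; rewrite mulrA mulVf // mul1r.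
have Gb_ge0 x : 0 <= kfun G b x by exact: G_ge0'.
have Gb_le x : kfun G b x <= C * th * u x.
  apply: (@le_trans _ _ (kfun G (fun y => C * u y) x)); first exact: kfun_le.
  by rewrite kfunZ -mulrA ler_wpM2l // ltW.
have [b' b2'] := set0Pn _ E2_neq0.
(* G h > 0 on [E1] because each of its points leads to [E2]. *)
have [c cgt hc] : exists2 c, 0 < c & forall x, x \in E1 -> c * u x <= kfun G h x.
  have [|c cgt hc] := @fin_min_gt0 R E (fun x => if x \in E1 then kfun G h x / u x else 1).
    move=> x; case: ifP => // x1; rewrite divr_gt0 ?u_gt0 //.
    rewrite /kfun (bigD1 b') //= ltr_wpDr //.
      by apply: sumr_ge0 => y _; rewrite mulr_ge0 ?h_ge0.
    by rewrite mulr_gt0 ?h_gt0 //; apply: G_pos; exact: leads12.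
  by exists c => // x x1; have := hc x; rewrite x1 ler_pdivlMr ?u_gt0.
(* The Doeblin constant is a minimum over the finitely many pairs in [E2], where G is positive;
   elsewhere h(x) pi(y) = 0. *)
have [kp kp0 hkp] : exists2 kp, 0 < kp &
    forall x y, x \in E2 -> y \in E2 -> kp * h x * pi y <= G x y.
  have [|kp kp0 hkp] := @fin_min_gt0 R (E * E)%type (fun p =>
      if (p.1 \in E2) && (p.2 \in E2) then G p.1 p.2 / (h p.1 * pi p.2) else 1).
    move=> [x y] /=; case: ifP => // /andP[x2 y2].
    by rewrite divr_gt0 ?mulr_gt0 ?h_gt0 ?pi_gt0 //; apply: G_pos; exact: irr2.
  exists kp => // x y x2 y2; have := hkp (x, y); rewrite /= x2 y2 /= -mulrA.
  by rewrite ler_pdivlMr // mulr_gt0 ?h_gt0 ?pi_gt0.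
exists G, c, (th * (C * th)), kp, c0; split=> //.
- by split=> //; rewrite !mulr_ge0 // ltW.
- move=> x; split; last first.
    by rewrite Gh -mulrA -mulrDr ler_wpM2l ?(ltW th0) // lerD2l.
  case: (boolP (x \in E1)) => [x1|].
    by rewrite h_out // mulr0 add0r hc.
  rewrite notin_E1 => x2; rewrite u_out // mulr0 addr0 Gh ler_wpM2l ?(ltW th0) //.
  by rewrite lerDl.
- split=> [y|x y].
    have := mkernel_green pi y GE.
    rewrite (_ : mkernel pi K = fun x => r2 * pi x); last exact/funext/piK.
    have -> : mkernel (fun x => r2 * pi x) G y = r2 * mkernel pi G y.
      by rewrite /mkernel mulr_sumr; apply: eq_bigr => x _; rewrite mulrA.
    move=> H; have : (1 - r2) * mkernel pi G y = pi y by lra.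
    by move=> <-; rewrite mulrA mulVf // mul1r.
  case: (boolP (x \in E2)) => [x2|]; last first.
    by rewrite notin_E2 => /h_out ->; rewrite mulr0 mul0r.
  case: (boolP (y \in E2)) => [y2|]; last by rewrite notin_E2 => /pi_out ->; rewrite mulr0.
  exact: hkp.
Qed.

End Eigen.

(** Packages the Green kernel with its attraction property, used both for constant sequences and
    along the process. *)
Lemma green_attractor : r1 <= r2 -> exists G : E -> E -> R,
  [/\ forall x y, 0 <= G x y,
      forall x y, G x y = (x == y)%:R + \sum_z K x z * G z y
    & forall mu : nat -> E -> R, (forall n, is_prob (mu n)) ->
      euler_windows G mu -> forall y, (fun n => mu n y) @ \oo --> pi y].
Proof.
move=> r12; have [u [h [[u0 uo Ku] [h0 ho Kh pih] r10]]] := eigenfunctions.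
have [G [c [C [kp [c0 [[G0 GE GE'] [cgt Cge kgt c0gt uh] Gu Gh [piG mn]]]]]]] :=
  attractor_facts u0 uo Ku h0 ho Kh r10 r12.
exists G; split=> // mu mup eul.
apply: (@euler_windows_cvg R E G u h pi (1 - r2)^-1 c C kp c0) => //.
- exact: u_ge0.
- exact: h_ge0.
- by move=> x; have [] := Gh x.
- by move=> x; have [] := Gh x.
- exact: pi_prob.
- move=> x; case: (boolP (x \in E2)) => [/uo ->|]; first by rewrite mulr0.
  by rewrite notin_E2 => /pi_out ->; rewrite mul0r.
Qed.

(* A quasi-stationary distribution of K is a constant solution of the Euler scheme. *)
Lemma qsd_unique : r1 <= r2 -> unique (is_qsd K) pi.
Proof.
move=> r12; split=> [|nu q]; first exact: pi_qsd.
have [r0 nuE] := qsd_eigen q; have [[nu0 nu1] _] := q.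
set r := extinction_rate K nu in r0 nuE.
have [G [G0 GE att]] := green_attractor r12.
(* From nu K = r nu and G = I + K G. *)
have nuG y : (1 - r) * mkernel nu G y = nu y.
  have := mkernel_green nu y GE.
  rewrite (_ : mkernel nu K = fun x => r * nu x); last exact/funext.
  have -> : mkernel (fun x => r * nu x) G y = r * mkernel nu G y.
    by rewrite /mkernel mulr_sumr; apply: eq_bigr => x _; rewrite mulrA.
  by lra.
have nuG0 y : 0 <= mkernel nu G y by apply: sumr_ge0 => x _; rewrite mulr_ge0.
have r_ge0 : 0 <= r.
  apply: sumr_ge0 => x _; apply: mulr_ge0 => //; apply: kfun_ge0 => y //.
  exact: K_ge0.
have r_le1 : 0 <= 1 - r.
  rewrite leNgt; apply/negP => rneg.
  have : \sum_y nu y <= 0.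
    by apply: sumr_le0 => y _; rewrite -nuG nmulr_rle0.
  by rewrite nu1 ler10.
suff eul : euler_windows G (fun=> nu).
  apply/funext => y; apply/esym.
  by have := att _ (fun=> conj nu0 nu1) eul y => /(cvg_lim (@Rhausdorff R)); rewrite lim_cst.
(* With A = T0 (1 - r) the Euler step maps [nu] to itself exactly, so windows of one index do. *)
exists 1 => // T0 T00; exists T0; first by rewrite T00 lexx.
exists 0%N => n _; exists n.+1, T0, (T0 * (1 - r)); split=> //.
- by split=> //; lra.
- by split; [rewrite mulr_ge0 // ltW|rewrite ler_piMr ?(ltW T00) //; lra].
- move=> y; rewrite -mulrA nuG (_ : _ - _ = 0) ?normr0 ?mul1r ?sqr_ge0 //; ring.
- by move=> j _ y; rewrite subrr normr0 mul1r ltW.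
Qed.

(** * The criterion for condition [H4] *)

Lemma kfun_kpow_h_upper u h C n x : 0 < C ->
  (forall x, 0 <= u x) -> (forall x, kfun K u x <= r2 * u x) ->
  (forall x, kfun K h x <= r2 * h x + C * u x) ->
  kfun (kpow K n) h x <= r2 ^+ n * (h x + n%:R * (C / r2) * u x).
Proof.
move=> C0 u0 Ku Kh; have r20 := r2_gt0.
(* As in a Jordan block, each application of K adds one more multiple of [u] of the same exponential
   order, hence the linear factor n. *)
elim: n x => [|n IH] x; first by rewrite kfun_kpow0 mul1r !mul0r addr0.
rewrite kfun_kpowS; apply: (le_trans (kfun_le K_ge0 x IH)).
rewrite kfunZ kfunD kfunZ exprSr -[leRHS]mulrA ler_wpM2l ?exprn_ge0 ?(ltW r20) //.
have D0 : 0 <= n%:R * (C / r2) by rewrite mulr_ge0 // divr_ge0 // ltW.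
apply: (le_trans (lerD (Kh x) (ler_wpM2l D0 (Ku x)))).
rewrite -natr1 le_eqVlt; apply/orP; left; apply/eqP.
by field; rewrite gt_eqF.
Qed.

Lemma sup_range_le (f : E -> R) B : (forall x, f x <= B) -> sup (range f) <= B.
Proof.
move=> fB; have [a _] := set0Pn _ E1_neq0; apply: ge_sup; first by exists (f a), a.
by move=> _ [x _ <-].
Qed.

Lemma le_sup_range (f : E -> R) x : f x <= sup (range f).
Proof.
have [B _ fB] := fin_max_ub f; apply: ub_le_sup; last by exists x.
by exists B => _ [y _ <-].
Qed.

(** K(x, E) > 0 gives x a successor, which lies in [E2] and leads back to x. The length must be
    positive because the small-set series starts at 1. *)
Lemma return2 x : x \in E2 -> exists2 n, (0 < n)%N & 0 < kpow K n x x.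
Proof.
move=> x2; have [_ /(_ x)[m0 _]] := subK.
have [z Kz] : exists z, 0 < K x z.
  apply: contrapT => /forallNP H; move: m0; rewrite /mass big1 ?ltxx // => z _.
  by apply: le_anti; rewrite K_ge0 leNgt; have /negP -> := H z.
have z2 : z \in E2.
  by rewrite -notin_E1; apply/negP => z1; rewrite K21 // ltxx in Kz.
have /(leadsP K_ge0)[n hn] := irr2 z2 x2.
exists (1 + n)%N => //; apply: (kpowD_gt0 K_ge0 _ hn).
by rewrite kpow1.
Qed.

Lemma access2 x y : y \in E2 -> exists2 n, (0 < n)%N & 0 < kpow K n x y.
Proof.
move=> y2; have [n n0 hn] := return2 y2.
have /(leadsP K_ge0)[m hm] : leads K x y.
  by case: (boolP (x \in E1)) => [x1|]; [exact: leads12|rewrite notin_E1 => x2; exact: irr2].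
by exists (m + n)%N; [rewrite addn_gt0 n0 orbT|exact: (kpowD_gt0 K_ge0 hm hn)].
Qed.

Lemma series_ge_term (f : nat -> R) n : (0 < n)%N -> (forall k, 0 <= f k) ->
  ((f n)%:E <= \sum_(1 <= k <oo) (f k)%:E)%E.
Proof.
move=> n0 f0; apply: le_trans (nneseries_lim_ge n.+1 _) => [|k _ _]; last by rewrite lee_fin.
rewrite big_nat_recr //= leeDr // sume_ge0 // => k _.
by rewrite lee_fin.
Qed.

Lemma weak_small_dirac x : x \in E2 -> weak_small_measure K (fun y => (x == y)%:R).
Proof.
move=> x2; exists [set x]%SET; have [n n0 hn] := return2 x2; exists (kpow K n x x).
have k0 m a b : 0 <= kpow K m a b by exact: (kpow_ge0 K_ge0).
split=> // [|y|a y].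
- by apply/set0Pn; exists x; rewrite inE.
- have [m m0 hm] := access2 y x2; apply: lt_le_trans (series_ge_term m0 _).
    by rewrite lte_fin /mass big_set1.
  by move=> j; apply: sumr_ge0 => z _.
- rewrite inE => /eqP ->; case: eqP => [<-|_]; rewrite ?mulr1 ?mulr0.
    exact: (series_ge_term (f := fun j => kpow K j x x)).
  by apply: nneseries_ge0 => j _ _; rewrite lee_fin.
Qed.

(** The difference of the two sides is c p (1 - p) (a - b)^2 over a positive denominator. *)
Lemma hyperbola_convex (c a b p : R) : 0 <= c -> 0 <= a -> 0 <= b -> 0 <= p -> p <= 1 ->
  c / (1 + (p * a + (1 - p) * b)) <= p * (c / (1 + a)) + (1 - p) * (c / (1 + b)).
Proof.
move=> c0 a0 b0 p0 p1.
have pq : 0 <= p * (1 - p) by rewrite mulr_ge0 // subr_ge0.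
have pa : 0 <= p * a by rewrite mulr_ge0.
have pb : 0 <= (1 - p) * b by rewrite mulr_ge0 // subr_ge0.
have a1 : 0 < 1 + a by lra.
have b1 : 0 < 1 + b by lra.
have m1 : 0 < 1 + (p * a + (1 - p) * b) by lra.
rewrite -subr_ge0.
have -> : p * (c / (1 + a)) + (1 - p) * (c / (1 + b)) - c / (1 + (p * a + (1 - p) * b)) =
  c * (p * (1 - p)) * (a - b) ^+ 2 / ((1 + a) * (1 + b) * (1 + (p * a + (1 - p) * b))).
  by field; rewrite !gt_eqF.
apply: divr_ge0; last by rewrite ltW // !mulr_gt0.
by rewrite mulr_ge0 ?sqr_ge0 // mulr_ge0.
Qed.

(** Take the Dirac mass at a point of [E2] and C(s) proportional to 1 / (1 + s): K^n 1 is at most of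
    order (1 + n) r2^n everywhere and at least of order r2^n at that point. *)
Lemma H4_of_le : r1 <= r2 -> H4 K.
Proof.
move=> r12; have [u [h [[u0 uo Ku] [h0 ho Kh pih] r10]]] := eigenfunctions.
have [x x2] := set0Pn _ E2_neq0.
have uge := u_ge0 u0 uo; have hge := h_ge0 h0 ho.
have [c0 c00 uh] := uh_lower u0 uo h0 ho; have [C C0 HC] := Kh_upper u0 uo ho Kh.
have [Mh Mh0 hM] := fin_max_ub h; have [Mu Mu0 uM] := fin_max_ub u.
have r20 := r2_gt0; have k0 m a b : 0 <= kpow K m a b by exact: (kpow_ge0 K_ge0).
have Ku' y : kfun K u y <= r2 * u y by rewrite Ku ler_wpM2r.
pose B := (Mu + Mh + C / r2 * Mu) / c0.
have D0 : 0 < C / r2 by rewrite divr_gt0.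
have B0 : 0 < B.
  by rewrite divr_gt0 //; have := mulr_gt0 D0 Mu0; lra.
have up n y : kfun (kpow K n) (@Defs.one R E) y <= B * (1 + n%:R) * r2 ^+ n.
  apply: (@le_trans _ _ (c0^-1 * kfun (kpow K n) (fun z => u z + h z) y)).
    rewrite -kfunZ; apply: kfun_le => // z.
    by rewrite /Defs.one mulrC ler_pdivlMr // mul1r.
  have -> : B * (1 + n%:R) * r2 ^+ n =
      c0^-1 * (r2 ^+ n * ((Mu + Mh + C / r2 * Mu) * (1 + n%:R))) by rewrite /B; ring.
  rewrite kfunD ler_pM2l ?invr_gt0 //.
  apply: (le_trans (lerD (kfun_kpow_le K_ge0 n y (ltW r20) Ku')
      (kfun_kpow_h_upper n y C0 uge Ku' HC))).
  rewrite -mulrDr ler_wpM2l ?exprn_ge0 ?(ltW r20) //.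
  have n0 : 0 <= n%:R :> R by [].
  have : n%:R * (C / r2) * u y <= n%:R * (C / r2) * Mu.
    by rewrite ler_wpM2l // mulr_ge0 // ltW.
  have := uM y; have := hM y.
  have : 0 <= n%:R * (Mu + Mh) by rewrite mulr_ge0 // addr_ge0 // ltW.
  have : 0 <= C / r2 * Mu by rewrite mulr_ge0 // ltW.
  by nra.
have down n : h x / Mh * r2 ^+ n <= kfun (kpow K n) (@Defs.one R E) x.
  apply: (@le_trans _ _ (Mh^-1 * kfun (kpow K n) h x)).
    rewrite [h x / _]mulrC -mulrA ler_pM2l ?invr_gt0 // mulrC.
    by apply: (kfun_kpow_ge K_ge0 n x (ltW r20)) => y; exact: Kh_lower.
  rewrite -kfunZ; apply: kfun_le => // z.
  by rewrite mulrC ler_pdivrMr // mul1r.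
exists (fun y => (x == y)%:R); split; last 1 first.
- have c_gt0 : 0 < h x / (Mh * B) by apply: divr_gt0; [exact: h0|exact: mulr_gt0].
  exists (fun s => h x / (Mh * B) / (1 + s)); split.
  + by move=> s s0; rewrite divr_ge0 ?addr_ge0 // ltW.
  + move=> s t s0 st; rewrite ler_pM2l // lef_pV2 ?posrE ?lerD2l //.
      by rewrite ltr_pwDl // (le_trans s0).
    by rewrite ltr_pwDl.
  + move=> t a b; rewrite !inE /= !in_itv /= !andbT => a0 b0.
    exact: (hyperbola_convex (ltW c_gt0) a0 b0 (ge0 t) (le1 t)).
  + exact: integral_hyperbola.
  + move=> n; rewrite [expect _ _](_ : _ = kfun (kpow K n) (@Defs.one R E) x); last first.
      exact: sum_delta.
    apply: le_trans (down n).
    apply: (@le_trans _ _ (h x / (Mh * B) / (1 + n%:R) * (B * (1 + n%:R) * r2 ^+ n))).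
      rewrite ler_wpM2l ?sup_range_le // divr_ge0 ?addr_ge0 // ltW //.
    rewrite le_eqVlt; apply/orP; left; apply/eqP; field.
    by rewrite !gt_eqF // ltr_pwDl.
- split=> [y|]; first by case: eqP.
  rewrite -[RHS](sum_delta x (fun=> 1 : R)).
  by apply: eq_bigr => y _; rewrite mulr1.
- exact: weak_small_dirac.
Qed.

(** If r2 < r1, the supremum of K^n 1 is at least of order r1^n, while its mean under [Psi] is at
    most of order r2^n. Then C(n) decays geometrically and its integral is finite. *)
Lemma le_of_H4 : H4 K -> r1 <= r2.
Proof.
move=> [Psi [[P0 P1] [U [eps [U0 eps0 acc small]]] [C [C0 Cdec _ Cint CK]]]].
rewrite leNgt; apply/negP => r21; have r20 := r2_gt0.
have [u [h [[u0 uo Ku] [h0 ho Kh pih] r10]]] := eigenfunctions.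
have uge := u_ge0 u0 uo; have hge := h_ge0 h0 ho.
have k0 m a b : 0 <= kpow K m a b by exact: (kpow_ge0 K_ge0).
(* [U] is reached from [E2], hence meets it; from such a point no power of K charges [E1], and the
   minorization forces [Psi] to vanish there. *)
have Psi1 y : y \in E1 -> Psi y = 0.
  move=> y1; have [x x2] := set0Pn _ E2_neq0.
  have [z zU z2] : exists2 z, z \in U & z \in E2.
    apply: contrapT => H; have := acc x; rewrite eseries0 ?ltxx // => n _ _.
    congr (_%:E); rewrite /mass big1 // => z zU; apply: kpow21 => //.
    by rewrite -notin_E2; apply/negP => z2; apply: H; exists z.
  have := small z y zU; rewrite eseries0; last by move=> n _ _; rewrite kpow21.
  rewrite lee_fin pmulr_rle0 // => Py; apply: le_anti; by rewrite Py P0.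
have [x x1] := set0Pn _ E1_neq0.
have [Mu Mu0 uM] := fin_max_ub u.
have [c0 c00 uh] := uh_lower u0 uo h0 ho.
have [Mh Mh0 hM] := fin_max_ub h.
have down n : u x / Mu * r1 ^+ n <= sup (range (kfun (kpow K n) (@Defs.one R E))).
  apply: le_trans (le_sup_range _ x).
  apply: (@le_trans _ _ (Mu^-1 * kfun (kpow K n) u x)).
    rewrite [u x / _]mulrC -mulrA ler_pM2l ?invr_gt0 // mulrC.
    by apply: (kfun_kpow_ge K_ge0 n x r10) => y; rewrite Ku.
  rewrite -kfunZ; apply: kfun_le => // z.
  by rewrite mulrC ler_pdivrMr // mul1r.
have up n y : y \in E2 -> kfun (kpow K n) (@Defs.one R E) y <= r2 ^+ n * (Mh / c0).
  move=> y2.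
  have hn : kfun (kpow K n) h y = r2 ^+ n * h y.
    elim: n y y2 => [|n IH] y y2; first by rewrite kfun_kpow0 mul1r.
    rewrite kfun_kpowS exprSr -mulrA -Kh // -kfunZ; apply: eq_bigr => z _.
    by case: (boolP (z \in E1)) => [z1|]; [rewrite K21 // !mul0r|rewrite notin_E1 => /IH ->].
  have un : kfun (kpow K n) u y <= 0.
    have Ku' z : kfun K u z <= r1 * u z by rewrite Ku.
    by have := kfun_kpow_le K_ge0 n y r10 Ku'; rewrite (uo y y2) mulr0.
  apply: (@le_trans _ _ (c0^-1 * kfun (kpow K n) (fun z => u z + h z) y)).
    rewrite -kfunZ; apply: kfun_le => // z.
    by rewrite /Defs.one mulrC ler_pdivlMr // mul1r.
  have -> : r2 ^+ n * (Mh / c0) = c0^-1 * (r2 ^+ n * Mh) by ring.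
  rewrite kfunD hn ler_pM2l ?invr_gt0 //.
  have := ler_wpM2l (exprn_ge0 n (ltW r20)) (hM y); lra.
pose q := r2 / r1; have r1gt : 0 < r1 by exact: lt_trans r20 r21.
have q0 : 0 < q by rewrite divr_gt0.
have q1 : q < 1 by rewrite ltr_pdivrMr // mul1r.
pose B := Mh / c0 / (u x / Mu).
have ux : 0 < u x / Mu by rewrite divr_gt0 // u0.
have B0 : 0 < B by rewrite divr_gt0 // divr_gt0.
have CB n : C n%:R <= B * q ^+ n.
  have h1 : C n%:R * (u x / Mu * r1 ^+ n) <= r2 ^+ n * (Mh / c0).
    apply: le_trans (ler_wpM2l (C0 _ (ler0n _ _)) (down n)) _.
    apply: le_trans (CK n) _.
    rewrite -[leRHS]mul1r -P1 mulr_suml; apply: ler_sum => y _.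
    case: (boolP (y \in E1)) => [/Psi1 ->|]; first by rewrite !mul0r.
    by rewrite notin_E1 => y2; rewrite ler_wpM2l // up.
  have r1n : 0 < r1 ^+ n by rewrite exprn_gt0.
  rewrite /B /q expr_div_n.
  have -> : Mh / c0 / (u x / Mu) * (r2 ^+ n / r1 ^+ n) =
    r2 ^+ n * (Mh / c0) / (u x / Mu * r1 ^+ n).
    by field; rewrite !gt_eqF // u0.
  by rewrite ler_pdivlMr // mulr_gt0.
have : (\int[@lebesgue_measure R]_(s in `[0%R, +oo[) (C s)%:E <= (B / (1 - q))%:E)%E.
  apply: le_trans (integral_noninc_le C0 Cdec) _.
  apply: lime_le; first by apply: is_cvg_nneseries => n _ _; rewrite lee_fin C0.
  apply: nearW => N; rewrite sumEFin lee_fin.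
  apply: (@le_trans _ _ (\sum_(0 <= k < N) B * q ^+ k)); first exact: ler_sum.
  rewrite -mulr_sumr ler_wpM2l ?(ltW B0) // -[(1 - q)^-1]mul1r ler_pdivlMr ?subr_gt0 //.
  have := subrX1 q N; have := exprn_ge0 N (ltW q0); rewrite big_mkord; lra.
by rewrite Cint leye_eq.
Qed.

End Reducible.

(** * From the window noise to almost sure convergence *)

Lemma gamma_cvg0 (R : realType) (eta : nat -> R) : (forall n, 0 < eta n) ->
  gamma eta n * ln n%:R @[n --> \oo] --> (0 : R) -> gamma eta @ \oo --> 0.
Proof.
move=> eta0 gln; apply/cvgr0Pnorm_le => e e0.
have l2 : 0 < ln 2 :> R by rewrite ln_gt0 // ltr1n.
have [N _ gN] : \forall n \near \oo, `|gamma eta n * ln n%:R| <= e * ln 2.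
  by apply: (cvgr0_norm_le _ gln); rewrite mulr_gt0.
exists (maxn N 2) => // n /=; rewrite geq_max => /andP[Nn n2].
have g0 := gamma_gt0 eta0 n; rewrite gtr0_norm // -(ler_pM2r l2).
apply: le_trans (gN n Nn); apply: le_trans (ler_norm _).
by rewrite ler_pM2l // ler_ln ?posrE ?ltr0n ?(leq_trans _ n2) // ler_nat.
Qed.

(** Only the window lengths 1 / (i + 1) and the finitely many columns of G are used, so one null set
    suffices; outside it the pathwise Euler argument applies. *)
Lemma occupation_weak_cvg (R : realType) (E : finType) (K G : E -> E -> R) (pi : E -> R)
    (d : measure_display) (T : measurableType d) (P : probability T R)
    (eta : nat -> R) (x0 : E) (F : nat -> set (set T)) (X : nat -> T -> E) :
  sub_Markovian K -> (forall x y, 0 <= G x y) ->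
  (forall x y, G x y = (x == y)%:R + \sum_z K x z * G z y) ->
  (forall mu : nat -> E -> R, (forall n, is_prob (mu n)) ->
     euler_windows G mu -> forall y, (fun n => mu n y) @ \oo --> pi y) ->
  (forall n, 0 < eta n) -> reinforced_process P K eta x0 F X ->
  nonincreasing_seq (gamma eta) ->
  (\sum_(0 <= n <oo) (gamma eta n)%:E = +oo)%E ->
  gamma eta n * ln n%:R @[n --> \oo] --> (0 : R) ->
  {ae P, forall w, weak_cvg (fun n => occupation eta X n w) pi}.
Proof.
move=> subK G0 GE att eta0 rp dec div gln.
have inv0 (i : nat) : 0 < i.+1%:R^-1 :> R by rewrite invr_gt0.
have [win winP] : exists win : nat -> nat -> nat,
    forall i n, is_window eta i.+1%:R^-1 n (win i n).
  have /choice[win H] : forall i, exists win_i : nat -> nat,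
      forall n, is_window eta i.+1%:R^-1 n (win_i n).
    move=> i; have /choice[win H] : forall n, exists m, is_window eta i.+1%:R^-1 n m.
      by move=> n; exact: window_exists.
    by exists win.
  by exists win.
have GB y z : 0 <= G z y <= \sum_x G x y.
  by rewrite G0 (bigD1 z) //= lerDl sumr_ge0.
have : {ae P, forall w, forall (i : nat) (y : E), (fun n =>
    \sum_(n <= j < win i n) gamma eta j.+1 *
      noise eta (X^~ w) K (fun z => G z y) j.+1) @ \oo --> 0}.
  apply: ae_foralln => i; apply: filter_forall => y.
  exact: (wnoise_cvg0 eta0 subK rp dec gln (winP i) (inv0 i) (GB y)).
apply: filterS => w noise0 f; apply: cvg_fin_sum => y; apply: cvgM; last exact: cvg_cst.
apply: (att (fun n => occ_path eta (X^~ w) n)); first by move=> n; exact: occ_prob.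
apply: (euler_windows_occ eta0 subK G0 GE dec (gamma_cvg0 eta0 gln)) => T0 T00.
have [k kT] := ltr_add_invr T00; rewrite add0r in kT.
exists k.+1%:R^-1; first by rewrite inv0 ltW.
by exists (win k); split; [exact: winP|exact: noise0].
Qed.

Theorem proposition3p3 (R : realType) (E : finType) (E1 E2 : {set E})
    (K : E -> E -> R) (mu2 : {z : E | z \in E2} -> R)
    (E12 : E1 :|: E2 = [set: E]%SET) (disjE12 : E1 :&: E2 = finset.set0)
    (E1_neq0 : E1 != finset.set0) (E2_neq0 : E2 != finset.set0)
    (subK : sub_Markovian K)
    (irr1 : forall x y, x \in E1 -> y \in E1 -> leads K x y)
    (irr2 : forall x y, x \in E2 -> y \in E2 -> leads K x y)
    (lead12 : leads_set K E1 E2)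
    (nlead21 : ~ leads_set K E2 E1)
    (killed2 : exists2 x, x \in E2 & mass K x [set: E]%SET < 1)
    (unkilled1 : forall x, x \in E1 -> mass K x [set: E]%SET = 1)
    (mu2_qsd : is_qsd (restr K E2) mu2) :
  let Theta1 := spectral_radius (restr K E1) in
  let Theta2 := spectral_radius (restr K E2) in
  [/\ (* the spectral radii are the extinction rates of K_1 and K_2 *)
      (forall mu1, is_qsd (restr K E1) mu1 ->
         extinction_rate (restr K E1) mu1 = Theta1),
      extinction_rate (restr K E2) mu2 = Theta2,
      H4 K <-> Theta1 <= Theta2
    & Theta1 <= Theta2 ->
      unique (is_qsd K) (extend mu2) /\
      forall (d : measure_display) (T : measurableType d)
        (P : probability T R) (eta : nat -> R) (x0 : E)
        (F : nat -> set (set T)) (X : nat -> T -> E),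
        (forall n, 0 < eta n) ->
        reinforced_process P K eta x0 F X ->
        nonincreasing_seq (gamma eta) ->
        (\sum_(0 <= n <oo) (gamma eta n)%:E = +oo)%E ->
        gamma eta n * ln n%:R @[n --> \oo] --> (0 : R) ->
        {ae P, forall w, weak_cvg (fun n => occupation eta X n w) (extend mu2)}].
Proof.
move=> Theta1 Theta2; split.
- by move=> mu1; exact: (qsd1 E12 disjE12).
- by have [] := qsd2 E12 disjE12 subK irr2 nlead21 mu2_qsd.
- split.
    exact: (le_of_H4 E12 disjE12 E1_neq0 E2_neq0 subK irr1 irr2 nlead21 mu2_qsd).
  exact: (H4_of_le E12 disjE12 E1_neq0 E2_neq0 subK irr1 irr2 lead12 nlead21 mu2_qsd).
move=> r12; split.
  exact: (qsd_unique E12 disjE12 E1_neq0 E2_neq0 subK irr1 irr2 lead12 nlead21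
    killed2 mu2_qsd r12).
have [G [G0 GE att]] := green_attractor E12 disjE12 E1_neq0 E2_neq0 subK
  irr1 irr2 lead12 nlead21 killed2 mu2_qsd r12.
move=> d T P eta x0 F X eta0 rp dec div gln.
exact: (occupation_weak_cvg subK G0 GE att eta0 rp dec div gln).
Qed.
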